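(* Let $c = 1+\sqrt{928/33}$. There exist a function $h:\mathbb{N}\to\mathbb{R}$ with $h(t)=o(t^2)$ as $t\to\infty$ and an integer $t_0$ such that for every integer $t\ge t_0$ and every integer $n\ge ct^2+h(t)$, every $t$-extremal graph $G$ on $n$ vertices contains an isolated copy of $K_{t+1}$.
   Context: All graphs are finite and simple. For integers $t\ge 2$ and $n$, call a graph $G$ on $n$ vertices $t$-admissible if every vertex of $G$ is contained in at least $\binom{t}{2}$ triangles (copies of $K_3$) of $G$. A graph $G$ on $n$ vertices is $t$-extremal if it is $t$-admissible and has the minimum number of edges among all $t$-admissible graphs on $n$ vertices. An isolated copy of $K_{t+1}$ in $G$ is a set $S$ of $t+1$ vertices that are pairwise adjacent in $G$ and such that no edge of $G$ joins $S$ to $V(G)\setminus S$. *)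

(* Defs.v *)
From mathcomp Require Import all_boot.

Set Implicit Arguments.
Unset Strict Implicit.
Unset Printing Implicit Defensive.

Record sgraph := SGraph {
  vertex :> finType;
  adj : rel vertex;
  adj_sym : symmetric adj;
  adj_irrefl : irreflexive adj }.

Definition edge_set (G : sgraph) : {set {set G}} :=
  [set [set p.1; p.2] | p : G * G & adj p.1 p.2].

Definition num_edges (G : sgraph) : nat := #|edge_set G|.

Definition clique (G : sgraph) (S : {set G}) : bool :=
  [forall x in S, forall y in S, (x != y) ==> adj x y].

Definition triangles_at (G : sgraph) (v : G) : {set {set G}} :=
  [set S : {set G} | [&& #|S| == 3, clique S & v \in S]].

Definition admissible (t : nat) (G : sgraph) : Prop :=
  forall v : G, 'C(t, 2) <= #|triangles_at v|.

Definition extremal (t : nat) (G : sgraph) : Prop :=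
  admissible t G /\
  forall H : sgraph, #|H| = #|G| -> admissible t H ->
    num_edges G <= num_edges H.

Definition isolated_clique (k : nat) (G : sgraph) (S : {set G}) : Prop :=
  [/\ #|S| = k, clique S
    & forall x y : G, x \in S -> y \notin S -> ~~ adj x y].

(* Main.v *)
(** If an extremal graph has no isolated K_(t+1) then it has fewer than 6 t^2
vertices, which suffices because c > 6.

Every degree is at least t, and a vertex of degree exactly t ("low") has a
clique as closed neighbourhood. Disjoint cliques K_(t+1), completed by at most t
further vertices joined to t vertices of one clique, show that the excess
X = sum of (deg v - t) is at most t^2. So there are at most X high vertices.
The low vertices that see a low non-neighbour across a common neighbour number
at most 2X. The closed neighbourhoods of the other low vertices are pairwise
disjoint cliques Q ("lights"). At most 2X/(t+1) of them send out more than
t/2 edges.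

It remains to see that two lights Q1, Q2 sending out at most t/2 edges each have
distinct levels, the level of Q being the maximum l of |N(y) & Q| over y outside
Q; as 0 < l <= t/2, at most t/2 such lights remain. If Q1 and Q2 had the same level
l, one could isolate Q2 and let each outside vertex y see a prefix of Q1 of length
|N(y) & Q1| + |N(y) & Q2|. Prefixes are nested, so no vertex loses a triangle, and
there is even slack: the vertices y attaining N(y) & Qi = Ni for a fixed Ni of
size l can be made to see one vertex fewer. The triangles which this destroys
are repaired by adding fewer edges than were dropped. *)

Require Import Defs.
From mathcomp Require Import all_boot zify.

Set Implicit Arguments.
Unset Strict Implicit.
Unset Printing Implicit Defensive.

(** * Triangle and edge counts by ordered pairs *)

Section Relations.
Variable V : finType.
Implicit Types (a b : rel V) (v x y z : V) (C T W : {set V}) (E : {set V * V}).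

Definition nbr a x : {set V} := [set y | a x y].

Lemma in_nbr a x y : (y \in nbr a x) = a x y.
Proof. by rewrite inE. Qed.

Definition link a v : {set V * V} :=
  [set p | [&& a v p.1, a v p.2 & a p.1 p.2]].

(* Ordered pairs: twice the number of triangles at v. *)
Definition tau a v : nat := #|link a v|.

Definition arcs a : nat := #|[set p : V * V | a p.1 p.2]|.

Definition swap_pairs E : {set V * V} := [set p | (p.2, p.1) \in E].

Definition add_edges a E : rel V :=
  [rel x y | [|| a x y, (x, y) \in E | (y, x) \in E]].

Lemma card_swap_pairs E : #|swap_pairs E| = #|E|.
Proof.
have swapK : involutive (fun p : V * V => (p.2, p.1)) by case.
rewrite -(card_imset (mem E) (inv_inj swapK)).
apply: eq_card => p; rewrite !inE; apply/idP/imsetP => [pE|[q qE ->]] /=.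
  by exists (p.2, p.1) => //=; case: p {pE}.
by case: q qE.
Qed.

Lemma card_pairs (P : V -> V -> bool) :
  #|[set p : V * V | P p.1 p.2]| = \sum_x #|[set y | P x y]|.
Proof.
rewrite -sum1dep_card -(pair_big_dep xpredT P (fun _ _ => 1)) /=.
by apply: eq_bigr => x _; rewrite sum1dep_card.
Qed.

Lemma arcs_deg a : arcs a = \sum_x #|nbr a x|.
Proof. exact: (card_pairs a). Qed.

Lemma tau_sum a v :
  tau a v = \sum_(x in nbr a v) #|nbr a v :&: nbr a x|.
Proof.
rewrite /tau /link.
rewrite (card_pairs (fun x y => [&& a v x, a v y & a x y])).
rewrite [RHS]big_mkcond /=; apply: eq_bigr => x _; rewrite inE.
case: ifP => avx; last by apply: eq_card0 => y; rewrite inE.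
by apply: eq_card => y; rewrite !inE.
Qed.

Lemma tau_mono a b v : subrel a b -> tau a v <= tau b v.
Proof.
move=> sab; apply: subset_leq_card; apply/subsetP => p; rewrite !inE.
by case/and3P => /sab-> /sab-> /sab->.
Qed.

Lemma tau_clique a v C :
  C \subset nbr a v -> {in C &, forall x y, x != y -> a x y} ->
  #|C| * #|C|.-1 <= tau a v.
Proof.
move=> /subsetP Cv Ccl; rewrite tau_sum.
apply: (@leq_trans (\sum_(x in C) #|C :\ x|)).
  rewrite -sum_nat_const; apply: leq_sum => x xC.
  by rewrite (cardsD1 x C) xC.
rewrite [leqLHS]big_mkcond [leqRHS]big_mkcond; apply: leq_sum => x _.
case: ifP => // xC; rewrite (Cv _ xC); apply: subset_leq_card.
apply/subsetP => y /setD1P [yx yC]; rewrite inE (Cv _ yC) inE.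
by apply: Ccl; rewrite // eq_sym.
Qed.

(** Each triangle [v], [x], [c] with [x] in [W] is new, because [a] lacks one of the sides at [c].
    It puts both [(x, c)] and [(c, x)] into the link of [v]. *)
Lemma tau_gain a b v c W :
  symmetric a -> symmetric b -> irreflexive b -> subrel a b -> b v c ->
  {in W, forall x, [/\ b v x, b x c & ~~ (a v c && a x c)]} ->
  tau a v + 2 * #|W| <= tau b v.
Proof.
move=> sa sb ib sab bvc HW.
have cW : c \notin W by apply/negP => /HW [_]; rewrite ib.
pose P1 := setX W [set c]; pose P2 := setX [set c] W.
have c1 : #|P1| = #|W| by rewrite cardsX cards1 muln1.
have c2 : #|P2| = #|W| by rewrite cardsX cards1 mul1n.
have d12 : P1 :&: P2 = set0.
  apply/setP => -[x y]; rewrite !inE /=; apply/negP.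
  by case/andP => /andP [xW _] /andP [/eqP xc _]; rewrite xc (negPf cW) in xW.
have dl : link a v :&: (P1 :|: P2) = set0.
  apply/setP => -[x y]; rewrite !inE /=; apply/negP.
  case/andP => /and3P [avx avy axy] /orP [] /andP [].
    by move=> /HW [_ _ nac] /eqP yc; move: nac; rewrite -yc avy axy.
  by move=> /eqP xc /HW [_ _ /negP[]]; rewrite -xc avx sa.
rewrite (_ : _ + _ = #|link a v :|: (P1 :|: P2)|); last first.
  by rewrite !cardsU dl d12 c1 c2 cards0 /tau; lia.
apply: subset_leq_card; apply/subsetP => -[x y]; rewrite !inE /=.
case/orP => [/and3P [avx avy axy]|]; first by rewrite !sab.
case/orP => /andP [].
  by move=> /HW [bvx bxc _] /eqP ->; rewrite bvx bvc bxc.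
by move=> /eqP -> /HW [bvx bxc _]; rewrite bvc bvx sb bxc.
Qed.

Lemma add_sym a E : symmetric a -> symmetric (add_edges a E).
Proof. by move=> sa x y; rewrite /add_edges /= sa; congr orb; rewrite orbC. Qed.

Lemma add_irrefl a E :
  irreflexive a -> (forall x, (x, x) \notin E) -> irreflexive (add_edges a E).
Proof. by move=> ia nE x; rewrite /add_edges /= ia orbb (negPf (nE x)). Qed.

Lemma add_sub a E : subrel a (add_edges a E).
Proof. by move=> x y; rewrite /add_edges /= => ->. Qed.

Lemma arcs_add a E : arcs (add_edges a E) <= arcs a + 2 * #|E|.
Proof.
have sub : [set p | add_edges a E p.1 p.2] \subset
    [set p | a p.1 p.2] :|: (E :|: swap_pairs E).
  by apply/subsetP => -[x y]; rewrite !inE /=.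
apply: leq_trans (subset_leq_card sub) _.
apply: leq_trans (leq_card_setU _ _) _; rewrite leq_add2l.
apply: leq_trans (leq_card_setU _ _) _; by rewrite card_swap_pairs mul2n addnn.
Qed.

(** A new edge between two neighbours of [v] closes a triangle at [v]. The condition on [(p.2, p.1)]
    prevents an edge from being listed in both orientations. *)
Lemma tau_fill a E v :
  symmetric a -> {in E, forall p, [/\ a v p.1, a v p.2 & ~~ a p.1 p.2]} ->
  {in E, forall p, (p.2, p.1) \notin E} ->
  tau a v + 2 * #|E| <= tau (add_edges a E) v.
Proof.
move=> sa HE asE.
have d12 : E :&: swap_pairs E = set0.
  by apply/setP => p; rewrite !inE; apply/negP => /andP [/asE /negPf ->].
have dl : link a v :&: (E :|: swap_pairs E) = set0.
  apply/setP => -[x y]; rewrite !inE /=; apply/negP.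
  case/andP => /and3P [_ _ axy] /orP [] /HE [_ _] /=; first by rewrite axy.
  by rewrite sa axy.
rewrite (_ : _ + _ = #|link a v :|: (E :|: swap_pairs E)|); last first.
  by rewrite !cardsU dl d12 card_swap_pairs cards0 /tau; lia.
apply: subset_leq_card; apply/subsetP => -[x y]; rewrite !inE /add_edges /=.
case/orP => [/and3P [-> -> ->] //|].
by case/orP => pE; case: (HE _ pE) => /= -> -> _; rewrite pE ?orbT.
Qed.

End Relations.

Lemma subset_between (T : finType) (A B : {set T}) k :
  A \subset B -> #|A| <= k <= #|B| ->
  exists F : {set T}, [/\ A \subset F, F \subset B & #|F| = k].
Proof.
move=> sAB /andP [leAk lekB].
elim: k leAk lekB => [|k IHk] leAk lekB.
  by exists A; split=> //; apply/eqP; rewrite -leqn0.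
move: leAk; rewrite leq_eqVlt => /orP [/eqP eAk|ltAk]; first by exists A.
have [F [sAF sFB Fk]] := IHk ltAk (ltnW lekB).
have /properP [_ [x xB xF]] : F \proper B by rewrite properEcard sFB Fk.
exists (x |: F); rewrite cardsU1 xF Fk; split=> //.
  exact: subset_trans sAF (subsetUr _ _).
by rewrite subUset sub1set xB.
Qed.

(** * Repairing a deficit of triangles *)

Section Repair.
Variable V : finType.
Implicit Types (a b : rel V) (v x y z : V) (C T U W : {set V}) (E : {set V * V}).

(** Orienting each pair by [enum_rank] makes the size of a set of pairs a number of edges. *)
Definition ordered_pair x y : V * V :=
  if enum_rank x < enum_rank y then (x, y) else (y, x).

Lemma ordered_pairC x y : ordered_pair x y = ordered_pair y x.
Proof.
rewrite /ordered_pair; case: ltngtP => // /ord_inj /enum_rank_inj -> //.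
Qed.

Definition nonadjacent a (U : {set V}) : {set V * V} :=
  [set q | [&& q.1 \in U, q.2 \in U, enum_rank q.1 < enum_rank q.2
             & ~~ a q.1 q.2]].

Lemma ordered_pair_nonadjacent a U x y :
  symmetric a -> x \in U -> y \in U -> x != y -> ~~ a x y ->
  ordered_pair x y \in nonadjacent a U.
Proof.
move=> sa xU yU xy nxy; rewrite /ordered_pair inE.
case: ltngtP => [lt|lt|/ord_inj /enum_rank_inj e] /=; last by rewrite e eqxx in xy.
  by rewrite xU yU lt.
by rewrite xU yU lt sa.
Qed.

Lemma add_ordered_pair a E x y :
  ordered_pair x y \in E -> add_edges a E x y.
Proof.
by rewrite /ordered_pair /add_edges /=; case: ifP => _ ->; rewrite !orbT.
Qed.

(** Each vertex [y] with a non-neighbour in [T] chooses one, [p y]. For a fixed [y0], the choice of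
    [p y0] can be skipped, since the pair of [y0] covers [p y0] already. This saves one edge. *)
Lemma nonadjacent_cover a T :
  symmetric a -> irreflexive a ->
  exists F0 : {set V * V}, [/\ F0 \subset nonadjacent a T, #|F0| <= #|T|.-1 &
    {in T, forall y, (exists2 z, z \in T & (z != y) && ~~ a y z) ->
      exists2 z, (z \in T) && ~~ a y z & (z != y) && (ordered_pair y z \in F0)}].
Proof.
move=> sa ia.
pose P y := [pred z | [&& z \in T, z != y & ~~ a y z]].
pose T1 := [set y in T | [exists z, P y z]].
have sT1 : T1 \subset T by apply/subsetP => y; rewrite inE => /andP [].
have [T10|[y0 y0T1]] := set_0Vmem T1.
  exists set0; rewrite sub0set cards0; split=> // y yT [z zT zy].
  have : y \in T1 by rewrite inE yT; apply/existsP; exists z; rewrite /= zT.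
  by rewrite T10 inE.
pose p y := odflt y0 [pick z | P y z].
have pP y : y \in T1 -> P y (p y).
  rewrite inE /p => /andP [_ /existsP [z Pz]].
  by case: pickP => [//|/(_ z)]; rewrite Pz.
have p0T1 : p y0 \in T1.
  have /and3P [pT py /negP npa] := pP _ y0T1.
  rewrite inE pT; apply/existsP; exists y0; rewrite /= eq_sym py sa.
  by rewrite (subsetP sT1) //; apply/negP.
exists [set ordered_pair y (p y) | y in T1 :\ p y0]; split.
- apply/subsetP => q /imsetP [y /setD1P [_ yT1] ->].
  have /and3P [pT py npa] := pP _ yT1.
  by apply: ordered_pair_nonadjacent; rewrite // ?(subsetP sT1) // eq_sym.
- apply: leq_trans (leq_imset_card _ _) _.
  have := subset_leq_card sT1; rewrite (cardsD1 (p y0)) p0T1; lia.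
move=> y yT [z zT zy].
have yT1 : y \in T1 by rewrite inE yT; apply/existsP; exists z; rewrite /= zT.
have [e|ne] := eqVneq y (p y0).
  have /and3P [pT py npa] := pP _ y0T1.
  exists y0; first by rewrite (subsetP sT1) // sa e.
  rewrite e eq_sym py /= ordered_pairC; apply: imset_f.
  by apply/setD1P; rewrite eq_sym.
have /and3P [pT py npa] := pP _ yT1.
by exists (p y); rewrite ?pT // py; apply: imset_f; apply/setD1P.
Qed.

(* Vertices of T with a non-neighbour in T gain their common neighbourhood O
outside T from one new edge inside T; the others gain every new edge, unless
all of O and T has become a clique. *)
Lemma repair_deficit_module a T t :
  symmetric a -> irreflexive a -> T != set0 -> 2 * #|T| <= t + 4 ->
  (forall z, z \notin T -> t * t.-1 <= tau a z) ->
  (forall y, y \in T ->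
    t * t.-1 <= tau a y + 2 * #|nbr a y :&: T| /\ t <= #|nbr a y|) ->
  (forall x y z, x \notin T -> y \in T -> z \in T -> a x y -> a x z) ->
  exists b : rel V, [/\ symmetric b, irreflexive b, forall v, t * t.-1 <= tau b v
    & arcs b <= arcs a + 2 * #|T|.-1].
Proof.
move=> sa ia /set0Pn [y0 y0T] sizeT outT inT modT.
pose O := nbr a y0 :\: T.
have OE y : y \in T -> nbr a y :\: T = O.
  move=> yT; apply/setP => x; rewrite !inE; case xT: (x \in T) => //=.
  by rewrite [LHS]sa [RHS]sa; apply/idP/idP => h; apply: (modT _ _ _ _ _ _ h); rewrite ?xT.
have nbrU y : y \in T -> nbr a y \subset O :|: T.
  move=> yT; rewrite -(OE _ yT); apply/subsetP => x; rewrite !inE => ->.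
  by rewrite andbT orNb.
have [F0 [sF0 cF0 covF0]] := nonadjacent_cover T sa ia.
pose M := nonadjacent a (O :|: T).
have sF0M : F0 \subset M.
  apply: subset_trans sF0 _; apply/subsetP => q; rewrite !inE.
  by case/and4P => -> -> -> ->; rewrite !orbT.
(* Take [#|T|.-1] missing edges, or all of them if there are fewer. In the latter case [O :|: T]
   becomes a clique, and the degree bound alone gives enough triangles. *)
have [F [sF0F sFM cF]] : exists F : {set V * V},
    [/\ F0 \subset F, F \subset M & #|F| = minn #|M| #|T|.-1].
  apply: subset_between => //; have := subset_leq_card sF0M; lia.
have sb := add_sym F sa.
have FP q : q \in F -> enum_rank q.1 < enum_rank q.2 /\ ~~ a q.1 q.2.
  by move=> /(subsetP sFM); rewrite inE => /and4P [].
have ib : irreflexive (add_edges a F).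
  by apply: add_irrefl => // x; apply/negP => /FP [/=]; rewrite ltnn.
exists (add_edges a F); split=> //; last first.
  apply: leq_trans (arcs_add _ _) _; lia.
move=> y; have [yT|yT] := boolP (y \in T); last first.
  by apply: leq_trans (outT _ yT) (tau_mono _ (@add_sub _ a F)).
have [tauy degy] := inT y yT.
have degE : #|nbr a y| = #|nbr a y :&: T| + #|O|.
  by rewrite -(OE _ yT) cardsID.
have [lt|ge] := ltnP #|T|.-1 #|M|; last first.
  have eFM : F = M.
    apply/eqP; rewrite eqEcard sFM cF; lia.
  apply: (@leq_trans (#|nbr a y| * #|nbr a y|.-1)); first by apply: leq_mul; lia.
  apply: tau_clique.
    by apply/subsetP => x; rewrite !inE => /(@add_sub _ a F).
  move=> x z /(subsetP (nbrU _ yT)) xU /(subsetP (nbrU _ yT)) zU xz.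
  have [axz|naxz] := boolP (a x z); first exact: add_sub.
  by apply: add_ordered_pair; rewrite eFM; apply: ordered_pair_nonadjacent.
have {lt}cF : #|F| = #|T|.-1 by lia.
have [/existsP [z /and3P [zT zy naz]]|/existsPn uniy] :=
    boolP [exists z, [&& z \in T, z != y & ~~ a y z]].
  have [|y' /andP [y'T nay'] /andP [y'y pF0]] := covF0 y yT.
    by exists z; rewrite ?zy.
  (* The new edge from [y] to [y'] closes a triangle with every vertex of [O]. As [y] sees at most
     |T| - 2 vertices of [T], its deficit is at most |T| - 2 triangles, while |O| >= t - (|T| - 2).
     This is where 2|T| <= t + 4 is used. *)
  apply: leq_trans tauy _; apply: leq_trans (_ : _ <= tau a y + 2 * #|O|) _.
    rewrite leq_add2l leq_mul2l /=.
    have : #|nbr a y :&: T| <= #|T :\ y :\ y'|.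
      apply: subset_leq_card; apply/subsetP => x; rewrite !inE => /andP [ayx ->].
      have xy : x != y by apply: contraTneq ayx => ->; rewrite ia.
      by rewrite xy !andbT; apply: contraNneq nay' => <-.
    have := cardsD1 y' (T :\ y); have := cardsD1 y T; rewrite !inE y'y y'T yT /=.
    move: degE degy sizeT; move: #|_| #|_| #|_| #|_| #|_| #|_|; clear; lia.
  apply: (@tau_gain _ a (add_edges a F) y y') => //.
  - exact: add_sub.
  - by apply: add_ordered_pair; apply: (subsetP sF0F).
  move=> x; rewrite -(OE _ yT) !inE => /andP [xT ayx].
  rewrite (negPf nay') /=; split=> //; apply: add_sub => //.
  by apply: (modT x y y'); rewrite // sa.
have adjU x : x \in O :|: T -> x != y -> a y x.
  rewrite -(OE _ yT) !inE => /orP [/andP [] //|xT xy].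
  by have := uniy x; rewrite xT xy negbK.
(* Here [y] sees all other vertices of [O :|: T], so each of the |T| - 1 edges in [F] closes a
   triangle at [y]. *)
apply: leq_trans tauy _; apply: leq_trans (_ : _ <= tau a y + 2 * #|F|) _.
  rewrite leq_add2l leq_mul2l cF /=.
  have : #|nbr a y :&: T| <= #|T :\ y|.
    apply: subset_leq_card; apply/subsetP => x; rewrite !inE => /andP [ayx ->].
    by rewrite andbT; apply: contraTneq ayx => ->; rewrite ia.
  have := cardsD1 y T; rewrite yT; lia.
apply: tau_fill => // q qF; last first.
  have [lt _] := FP _ qF; apply/negP => /FP /= [gt _].
  by have := ltn_trans lt gt; rewrite ltnn.
have := subsetP sFM _ qF; rewrite !inE => /and4P [q1 q2 lt na].
have q12 : q.1 != q.2 by apply: contraTneq lt => ->; rewrite ltnn.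
have n1 : q.1 != y.
  apply: contraNneq na => e; rewrite e; apply: adjU; rewrite ?inE //.
  by rewrite -e eq_sym.
have n2 : q.2 != y.
  by apply: contraNneq na => e; rewrite e sa; apply: adjU; rewrite ?inE // -e.
by split=> //; apply: adjU; rewrite ?inE.
Qed.

(* Typical use: every vertex of T has just lost one neighbour that it shared with
all of T. A vertex b0 that sees part of T only is joined to the rest of T, which
leaves a deficit only on the part seen by b0. *)
Lemma repair_deficit a T t :
  symmetric a -> irreflexive a -> T != set0 -> 2 * #|T| <= t + 4 ->
  (forall z, z \notin T -> t * t.-1 <= tau a z) ->
  (forall y, y \in T ->
    t * t.-1 <= tau a y + 2 * #|nbr a y :&: T| /\ t <= #|nbr a y|) ->
  exists b : rel V, [/\ symmetric b, irreflexive b, forall v, t * t.-1 <= tau b v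
    & arcs b <= arcs a + 2 * #|T|.-1].
Proof.
have [n] := ubnP #|T|; elim: n a T => // n IHn a T ltTn sa ia T0 sizeT outT inT.
have [/existsP [b0 /and3P [b0T /set0Pn [w wb] nsub]]|/existsPn modT] := boolP
  [exists b0, [&& b0 \notin T, T :&: nbr a b0 != set0 & ~~ (T \subset nbr a b0)]];
  last first.
  apply: repair_deficit_module => // x y z xT yT zT axy.
  have := modT x; rewrite xT /= negb_and !negbK => /orP [|sTx].
    by move=> /eqP /setP /(_ y); rewrite !inE yT axy.
  by have := subsetP sTx z zT; rewrite inE.
(* The edges of [E] and the |T'| - 1 edges from the induction hypothesis add up to |T| - 1, because
   [T'] is nonempty. *)
pose E := setX [set b0] (T :\: nbr a b0); pose b := add_edges a E.
pose T' := T :&: nbr a b0.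
have cTD : #|T| = #|T'| + #|T :\: nbr a b0| by rewrite cardsID.
have cD : 0 < #|T :\: nbr a b0|.
  by rewrite card_gt0; apply: contra nsub; rewrite setD_eq0.
have cE : #|E| = #|T :\: nbr a b0| by rewrite cardsX cards1 mul1n.
have T'gt : 0 < #|T'| by rewrite card_gt0; apply/set0Pn; exists w.
have sb : symmetric b by apply: add_sym.
have ib : irreflexive b.
  apply: add_irrefl => // x; rewrite !inE /=; apply/negP => /and3P [/eqP -> _].
  by rewrite (negPf b0T).
have sab : subrel a b by apply: add_sub.
have bb0 y : y \in T -> b y b0.
  move=> yT; have [ay|nay] := boolP (a b0 y); first by rewrite sb sab.
  by rewrite /b /add_edges /= !inE /= eqxx nay yT !orbT.
have [|||||||c [sc ic tc cc]] := IHn b T'; rewrite -?card_gt0 //; try lia.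
- move=> z; rewrite !inE negb_and => zT'.
  have [zT|zT] := boolP (z \in T); last exact: leq_trans (outT _ zT) (tau_mono _ sab).
  (* The edge from [z] to [b0] is new and closes a triangle with every neighbour of [z] in [T],
     which cancels the whole deficit of [z]. *)
  rewrite zT /= in zT'; apply: leq_trans (inT z zT).1 _.
  apply: (@tau_gain _ a b z b0) => //; first exact: bb0.
  move=> x; rewrite !inE => /andP [azx xT]; rewrite (sa z b0) (negPf zT').
  by split; [exact: sab|exact: bb0|].
- move=> y; rewrite !inE => /andP [yT by0]; have [tauy degy] := inT y yT.
  have sub : nbr a y \subset nbr b y by apply/subsetP => x; rewrite !inE; apply: sab.
  split; last exact: leq_trans degy (subset_leq_card sub).
  apply: leq_trans tauy _.
  have := @tau_gain _ a b y b0 (nbr a y :&: (T :\: nbr a b0)) sa sb ib sab.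
  move=> /(_ (bb0 _ yT)) gain.
  (* The neighbours of [y] in [T] that are newly joined to [b0] pay for themselves; only those in
     [T'] remain as a deficit. *)
  apply: leq_trans (_ : _ <= tau a y + 2 * #|nbr a y :&: (T :\: nbr a b0)| +
     2 * #|nbr a y :&: T'|) _.
    rewrite -addnA leq_add2l -mulnDr leq_mul2l /=.
    rewrite -(cardsID (nbr a b0) (nbr a y :&: T)) addnC.
    by rewrite /T' !setIA setIDA.
  apply: leq_add; last by rewrite leq_mul2l /= subset_leq_card // setSI.
  apply: gain => x; rewrite !inE => /and3P [ayx nbx xT].
  by rewrite [a x b0]sa (negPf nbx) andbF; split; [exact: sab|exact: bb0|].
exists c; split=> //; apply: leq_trans cc _.
have : arcs b <= arcs a + 2 * #|T :\: nbr a b0|.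
  by rewrite -cE; apply: arcs_add.
lia.
Qed.

End Repair.

(** * Adjacent pairs split along a vertex set, and prefixes of an enumeration *)

Section Split.
Variable V : finType.
Implicit Types (r : rel V) (A S Q : {set V}).

Lemma sum_nbr_exchange r A B :
  symmetric r -> \sum_(x in A) #|B :&: nbr r x| = \sum_(x in B) #|A :&: nbr r x|.
Proof.
move=> sr; transitivity (\sum_(x in A) \sum_(y in B | r x y) 1).
  by apply: eq_bigr => x _; rewrite sum1dep_card; apply: eq_card => y; rewrite !inE.
rewrite (exchange_big_dep (mem B)) /= => [|x y _ /andP [] //].
apply: eq_bigr => y yB; rewrite sum1dep_card; apply: eq_card => x.
by rewrite !inE yB /= sr.
Qed.

(** By symmetry, the adjacent pairs that cross the border of [A] are equally many in both
    directions, hence the factor 2. *)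
Lemma sum_nbr_split r S A :
  symmetric r ->
  \sum_(x in S) #|S :&: nbr r x| =
  \sum_(x in S :&: A) #|S :&: A :&: nbr r x|
  + 2 * \sum_(x in S :&: A) #|(S :\: A) :&: nbr r x|
  + \sum_(x in S :\: A) #|(S :\: A) :&: nbr r x|.
Proof.
move=> sr.
have split (B : {set V}) x :
    #|B :&: nbr r x| = #|B :&: A :&: nbr r x| + #|(B :\: A) :&: nbr r x|.
  by rewrite -(cardsID A (B :&: nbr r x)) setIAC setIDAC.
rewrite (big_setID A) /=.
under eq_bigr => x _ do rewrite split.
under [X in _ + X]eq_bigr => x _ do rewrite split.
rewrite !big_split /= (@sum_nbr_exchange _ (S :\: A) (S :&: A)) //; lia.
Qed.

Lemma card_index_lt Q k :
  k <= #|Q| -> #|[set w in Q | index w (enum Q) < k]| = k.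
Proof.
move=> leQ; rewrite (_ : [set _ in _ | _] = [set w in take k (enum Q)]).
  rewrite cardsE (card_uniqP _) ?take_uniq ?enum_uniq //.
  by rewrite size_takel // -cardE.
apply/setP => w; rewrite !inE; case wQ: (w \in Q) => /=.
  by rewrite in_take ?mem_enum.
by apply/esym/negbTE; apply/negP => /mem_take; rewrite mem_enum wQ.
Qed.

End Split.

(** * Isolating one of two disjoint cliques *)

Section Merge.
Variables (V : finType) (a : rel V) (Q1 Q2 : {set V}) (t : nat).
Hypotheses (sa : symmetric a) (ia : irreflexive a).
Hypotheses (dQ : [disjoint Q1 & Q2]) (cQ1 : #|Q1| = t.+1) (cQ2 : #|Q2| = t.+1).
Hypothesis clQ1 : {in Q1 &, forall x y, x != y -> a x y}.
Hypothesis clQ2 : {in Q2 &, forall x y, x != y -> a x y}.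
Implicit Types (x y z g w : V) (ka : V -> nat).

Let A := ~: (Q1 :|: Q2).

(* Q2 becomes isolated, and an outside vertex x sees the first ka x vertices
of Q1. *)
Definition fuse ka : rel V := [rel x y |
  if x \in A then
    if y \in A then a x y else (y \in Q1) && (index y (enum Q1) < ka x)
  else if y \in A then (x \in Q1) && (index x (enum Q1) < ka y)
  else (x != y) && ((x \in Q1) == (y \in Q1))].

Lemma fuse_sym ka : symmetric (fuse ka).
Proof.
move=> x y; rewrite /fuse /=; case: (x \in A); case: (y \in A) => //.
by rewrite eq_sym (eq_sym (x \in Q1)).
Qed.

Lemma fuse_irrefl ka : irreflexive (fuse ka).
Proof. by move=> x; rewrite /fuse /= ia eqxx /=; case: (x \in A). Qed.

Lemma mem1A w : w \in Q1 -> w \in A = false.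
Proof. by rewrite !inE => ->. Qed.

Lemma mem2A w : w \in Q2 -> w \in A = false.
Proof. by rewrite !inE => ->; rewrite orbT. Qed.

Lemma mem21 w : w \in Q2 -> w \in Q1 = false.
Proof. by move=> w2; rewrite (disjointFl dQ). Qed.

Lemma in_cliques w : w \in A = false -> w \in Q1 \/ w \in Q2.
Proof. by rewrite !inE => /negbT; rewrite negbK => /orP. Qed.

Lemma fuseA ka x y : x \in A -> y \in A -> fuse ka x y = a x y.
Proof. by rewrite /fuse /= => -> ->. Qed.

Lemma fuse1 ka y w : y \in A -> w \in Q1 ->
  fuse ka y w = (index w (enum Q1) < ka y).
Proof. by move=> yA w1; rewrite /fuse /= yA mem1A // w1. Qed.

Lemma nbr_fuseA ka y : y \in A -> nbr (fuse ka) y :&: A = nbr a y :&: A.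
Proof.
move=> yA; apply/setP => x; rewrite [LHS]in_setI [RHS]in_setI.
by rewrite !in_nbr; case xA: (x \in A); rewrite ?andbF // fuseA.
Qed.

Lemma nbr_fuseD ka y : y \in A ->
  nbr (fuse ka) y :\: A = [set w in Q1 | index w (enum Q1) < ka y].
Proof.
move=> yA; apply/setP => x; rewrite in_setD in_nbr [RHS]inE /fuse /= yA.
case xA: (x \in A) => //=; symmetry; case x1: (x \in Q1) => //=.
by rewrite mem1A in xA.
Qed.

Lemma tau_fuse_clique ka w : w \notin A -> t * t.-1 <= tau (fuse ka) w.
Proof.
have gen (Q : {set V}) : #|Q| = t.+1 -> w \in Q ->
    {in Q &, forall x y, x != y -> fuse ka x y} -> t * t.-1 <= tau (fuse ka) w.
  move=> cQ wQ clQ; have cD : #|Q :\ w| = t.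
    by have := cardsD1 w Q; rewrite wQ cQ => -[].
  rewrite -{1 2}cD; apply: tau_clique.
    apply/subsetP => x /setD1P [xw xQ]; rewrite in_nbr.
    by apply: clQ; rewrite // eq_sym.
  by move=> x y /setD1P [_ xQ] /setD1P [_ yQ]; apply: clQ.
move/negbTE => /in_cliques [wQ|wQ].
  apply: (gen Q1) => // x y x1 y1 xy.
  by rewrite /fuse /= !mem1A // x1 y1 xy.
apply: (gen Q2) => // x y x2 y2 xy.
by rewrite /fuse /= !mem2A // !mem21 // xy.
Qed.

Lemma cardD_A (S : {set V}) : #|S :\: A| = #|S :&: Q1| + #|S :&: Q2|.
Proof.
rewrite /A setDE setCK setIUr cardsU -setIIr (disjoint_setI0 dQ).
by rewrite setI0 cards0 subn0.
Qed.

(** Prefixes of [Q1] are nested, so two outside vertices share exactly the shorter one, whence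
    [minn]. The last term counts the pairs inside the prefix of [y], which is a clique. *)
Lemma tau_fuse ka y :
  {in A, forall z, ka z <= t.+1} -> y \in A ->
  tau (fuse ka) y =
    \sum_(x in nbr a y :&: A) #|nbr a y :&: A :&: nbr a x|
    + 2 * \sum_(x in nbr a y :&: A) minn (ka y) (ka x) + ka y * (ka y).-1.
Proof.
move=> bka yA; rewrite tau_sum (sum_nbr_split _ A (fuse_sym ka)).
rewrite nbr_fuseA //; congr (_ + _ + _).
- apply: eq_bigr => x /setIP [_ xA].
  rewrite -[in LHS]setIA -[in RHS]setIA; congr #|_ :&: _|.
  by rewrite setIC nbr_fuseA // setIC.
- congr (_ * _); apply: eq_bigr => x /setIP [_ xA].
  rewrite nbr_fuseD //.
  have le : minn (ka y) (ka x) <= #|Q1| by rewrite geq_min cQ1 bka.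
  rewrite -[RHS](card_index_lt le); apply: eq_card => w.
  rewrite in_setI in_nbr !in_set; case w1: (w \in Q1) => //=.
  by rewrite fuse1 // leq_min.
rewrite nbr_fuseD //; set S := [set w in Q1 | _].
have cS : #|S| = ka y by rewrite card_index_lt // cQ1 bka.
rewrite -cS -sum_nat_const; apply: eq_bigr => x xS.
have := cardsD1 x S; rewrite xS => -> /=; apply: eq_card => w.
have x1 : x \in Q1 by move: xS; rewrite inE => /andP [].
rewrite in_setI in_nbr in_setD1; case wS: (w \in S); rewrite ?andbF //= andbT.
have w1 : w \in Q1 by move: wS; rewrite inE => /andP [].
by rewrite /fuse /= !mem1A // x1 w1 andbT eq_sym.
Qed.

Lemma arcs_split (r : rel V) : symmetric r ->
  arcs r = \sum_(x in A) #|A :&: nbr r x| + 2 * \sum_(x in A) #|nbr r x :\: A|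
    + \sum_(x in ~: A) #|nbr r x :\: A|.
Proof.
move=> sr; rewrite arcs_deg.
have := sum_nbr_split setT A sr; rewrite setTI setTD => e.
transitivity (\sum_(x in [set: V]) #|[set: V] :&: nbr r x|).
  by apply: eq_big => x; rewrite ?setTI ?in_setT.
rewrite e; congr (_ + 2 * _ + _).
  by apply: eq_bigr => x _; rewrite setIC -setDE.
by apply: eq_bigr => x _; rewrite setIC -setDE.
Qed.

Lemma arcs_fuse ka : {in A, forall z, ka z <= t.+1} ->
  arcs (fuse ka) =
    \sum_(x in A) #|A :&: nbr a x| + 2 * \sum_(x in A) ka x + #|~: A| * t.
Proof.
move=> bka; rewrite (arcs_split (fuse_sym ka)); congr (_ + 2 * _ + _).
- by apply: eq_bigr => x xA; rewrite setIC nbr_fuseA // setIC.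
- by apply: eq_bigr => x xA; rewrite nbr_fuseD // card_index_lt // cQ1 bka.
rewrite -sum_nat_const; apply: eq_bigr => x; rewrite in_setC => /negbTE xA.
have gen (Q : {set V}) : #|Q| = t.+1 -> x \in Q ->
    (forall y, (y \in A = false) -> fuse ka x y = (x != y) && (y \in Q)) ->
    (forall y, y \in Q -> y \in A = false) ->
    #|nbr (fuse ka) x :\: A| = t.
  move=> cQ xQ mQ QA; have := cardsD1 x Q; rewrite xQ cQ => -[->].
  apply: eq_card => y; rewrite in_setD in_nbr in_setD1.
  case yA: (y \in A) => /=; last by rewrite mQ // eq_sym.
  by case yQ: (y \in Q); rewrite ?andbF //; rewrite QA in yA.
case: (in_cliques xA) => xQ.
  apply: (gen Q1) => // y; last exact: mem1A.
  by move=> yA; rewrite /fuse /= xA yA xQ; case: (y \in Q1).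
apply: (gen Q2) => // y; last exact: mem2A.
move=> yA; rewrite /fuse /= xA yA mem21 //; case: (in_cliques yA) => yQ.
  by rewrite yQ (disjointFr dQ yQ) andbF.
by rewrite yQ mem21.
Qed.

(** Edges inside [A] do not change, and every clique vertex already had [t] neighbours in its own
    clique. The boolean records the saving when [a] has an edge between the cliques. *)
Lemma arcs_fuse_le ka : {in A, forall z, ka z <= t.+1} ->
  arcs (fuse ka) + 2 * \sum_(x in A) (#|nbr a x :&: Q1| + #|nbr a x :&: Q2|)
    + [exists x in Q1, exists y in Q2, a x y]
    <= arcs a + 2 * \sum_(x in A) ka x.
Proof.
move=> bka; rewrite arcs_fuse // (arcs_split sa).
under [X in _ <= _ + 2 * X + _ + _]eq_bigr => x _ do rewrite cardD_A.
suff : #|~: A| * t + [exists x in Q1, exists y in Q2, a x y]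
    <= \sum_(x in ~: A) #|nbr a x :\: A|.
  set s1 := \sum_(x in A) _; set s2 := \sum_(x in A) _.
  set s3 := \sum_(x in A) _; set s4 := \sum_(x in _) _.
  by move: s1 s2 s3 s4 (#|~: A| * t) (nat_of_bool _); clear; lia.
have subQ x (Q : {set V}) : x \in Q -> {in Q &, forall x y, x != y -> a x y} ->
    #|Q| = t.+1 -> t <= #|nbr a x :&: Q|.
  move=> xQ clQ cQ; have := cardsD1 x Q; rewrite xQ cQ => -[->].
  apply: subset_leq_card; apply/subsetP => y /setD1P [yx yQ].
  by rewrite in_setI in_nbr yQ clQ // eq_sym.
pose e x := [exists y in Q2, a x y].
(* A crossing edge is charged to its end in [Q1]. *)
apply: (@leq_trans (\sum_(x in ~: A) (t + ((x \in Q1) && e x)))).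
  rewrite big_split /= sum_nat_const leq_add2l.
  case: existsP => // -[x /andP [x1 ex]].
  by rewrite (bigD1 x) ?inE ?x1 //= /e ex.
apply: leq_sum => x; rewrite in_setC cardD_A => /negbTE /in_cliques [xQ|xQ].
  rewrite xQ /=; apply: leq_add; first exact: subQ.
  rewrite /e; case: existsP => // -[y /andP [y2 axy]].
  by rewrite card_gt0; apply/set0Pn; exists y; rewrite in_setI in_nbr axy.
by rewrite mem21 //= addn0 -[t]add0n leq_add // subQ.
Qed.

Lemma nbr_split y :
  #|nbr a y| = #|nbr a y :&: A| + (#|nbr a y :&: Q1| + #|nbr a y :&: Q2|).
Proof. by rewrite -cardD_A cardsID. Qed.

Lemma deg_fuse ka y : {in A, forall z, ka z <= t.+1} -> y \in A ->
  #|nbr (fuse ka) y| = #|nbr a y :&: A| + ka y.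
Proof.
move=> bka yA.
by rewrite -(cardsID A) nbr_fuseA // nbr_fuseD // card_index_lt // cQ1 bka.
Qed.

Lemma sum_nbr_le (S : {set V}) :
  \sum_(x in S) #|S :&: nbr a x| <= #|S| * #|S|.-1.
Proof.
rewrite -sum_nat_const; apply: leq_sum => x xS.
have := cardsD1 x S; rewrite xS => -> /=; apply: subset_leq_card.
apply/subsetP => y; rewrite in_setI in_nbr in_setD1 => /andP [-> axy].
by rewrite andbT; apply: contraTneq axy => ->; rewrite ia.
Qed.

Lemma tau_split y :
  tau a y =
    \sum_(x in nbr a y :&: A) #|nbr a y :&: A :&: nbr a x|
    + 2 * \sum_(x in nbr a y :&: A)
       (#|nbr a y :&: Q1 :&: (nbr a x :&: Q1)| +
        #|nbr a y :&: Q2 :&: (nbr a x :&: Q2)|)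
    + \sum_(x in nbr a y :\: A) #|(nbr a y :\: A) :&: nbr a x|.
Proof.
rewrite tau_sum (sum_nbr_split _ A sa); congr (_ + 2 * _ + _).
by apply: eq_bigr => x _; rewrite setIDAC cardD_A -!setIIl.
Qed.

(** Triangles at [y] whose other two vertices lie in [A] survive, so only the triangles that meet a
    clique have to be compared. *)
Lemma tau_le_fuse ka y L :
  {in A, forall z, ka z <= t.+1} -> y \in A ->
  2 * \sum_(x in nbr a y :&: A)
       (#|nbr a y :&: Q1 :&: (nbr a x :&: Q1)| +
        #|nbr a y :&: Q2 :&: (nbr a x :&: Q2)|)
    + \sum_(x in nbr a y :\: A) #|(nbr a y :\: A) :&: nbr a x|
  <= 2 * \sum_(x in nbr a y :&: A) minn (ka y) (ka x) + ka y * (ka y).-1 + L ->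
  tau a y <= tau (fuse ka) y + L.
Proof.
by move=> bka yA le; rewrite tau_split tau_fuse //; move: le; clear; lia.
Qed.

Hypothesis noncross : forall x y, x \in Q1 -> y \in Q2 -> ~~ a x y.

(** Neighbours of [y] in different cliques are not adjacent, so only pairs within one clique
    contribute. *)
Lemma sum_nbr_cliques y :
  \sum_(x in nbr a y :\: A) #|(nbr a y :\: A) :&: nbr a x| <=
  #|nbr a y :&: Q1| * #|nbr a y :&: Q1|.-1 +
  #|nbr a y :&: Q2| * #|nbr a y :&: Q2|.-1.
Proof.
have e1 : (nbr a y :\: A) :&: Q1 = nbr a y :&: Q1.
  apply/setP => x; rewrite in_setI in_setD in_setI.
  by case x1: (x \in Q1); rewrite ?andbF // mem1A.
have e2 : (nbr a y :\: A) :\: Q1 = nbr a y :&: Q2.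
  apply/setP => x; rewrite in_setD in_setD in_setI.
  case xA: (x \in A) => /=.
    by rewrite andbF; case x2: (x \in Q2); [rewrite mem2A in xA|rewrite andbF].
  by case: (in_cliques xA) => xQ; rewrite xQ ?mem21 ?(disjointFr dQ xQ) ?andbF ?andbT.
rewrite (sum_nbr_split _ Q1 sa) e1 e2.
rewrite [X in _ + 2 * X + _]big1 => [|x /setIP [_ x1]]; last first.
  apply: eq_card0 => z; rewrite !inE; apply/negP => /andP [/andP [_ z2]].
  by apply/negP; apply: noncross.
by rewrite muln0 addn0 leq_add // sum_nbr_le.
Qed.

End Merge.

(** A set of size at most [l] other than [N] meets [N] in fewer than [l] elements. Hence, if every
    vertex with trace [N] drops one neighbour, only pairs that both have trace [N] lose a common
    neighbour. *)
Lemma setI_level (T : finType) (X Y N : {set T}) l :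
  #|N| = l -> #|X| <= l -> #|Y| <= l ->
  #|X :&: Y| <= minn (#|X| - (X == N)) (#|Y| - (Y == N)) + ((X == N) && (Y == N)).
Proof.
move=> cN cX cY.
have half (Z W : {set T}) : #|W| <= l -> Z = N -> W != N -> #|Z :&: W| < #|N|.
  move=> cW eZ neW; rewrite ltnNge; apply: contra neW => le.
  rewrite eZ in le.
  have e : N :&: W = N by apply/eqP; rewrite eqEcard subsetIl.
  by rewrite eq_sym eqEcard cN cW andbT; apply/setIidPl.
have lX : #|X :&: Y| <= #|X| by rewrite subset_leq_card // subsetIl.
have lY : #|X :&: Y| <= #|Y| by rewrite subset_leq_card // subsetIr.
case eX: (X == N); case eY: (Y == N) => /=.
- by rewrite (eqP eX) (eqP eY) setIid minnn; lia.
- have := half X Y cY (eqP eX) (negbT eY); rewrite -(eqP eX) in cN *; lia.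
- have := half Y X cX (eqP eY) (negbT eX); rewrite setIC -(eqP eY) in cN *; lia.
lia.
Qed.

Lemma sum_mem (T : finType) (S D : {set T}) :
  \sum_(x in S) (x \in D : nat) = #|S :&: D|.
Proof.
rewrite -sum1_card [LHS]big_mkcond [RHS]big_mkcond; apply: eq_bigr => x _.
by rewrite inE; case: (x \in S); case: (x \in D).
Qed.

Lemma pronic_add p q : p * p.-1 + q * q.-1 <= (p + q) * (p + q).-1.
Proof. by case: p => [|p]; case: q => [|q] //=; nia. Qed.

(** * Two lights of the same level *)

Section Lights.
Variables (V : finType) (a : rel V) (t : nat).
Hypotheses (sa : symmetric a) (ia : irreflexive a).
Hypothesis adma : forall v, t * t.-1 <= tau a v.
Hypothesis exta : forall b : rel V, symmetric b -> irreflexive b ->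
  (forall v, t * t.-1 <= tau b v) -> arcs a <= arcs b.
Implicit Types (x y z b : V) (Q N D : {set V}).

(** The degree condition allows an outside neighbour of [Q] to drop one neighbour and keep degree at
    least [t]. The number [l] is only an upper bound for the level; that it is attained is assumed
    separately. *)
Definition light l Q : Prop :=
  [/\ #|Q| = t.+1, {in Q &, forall x y, x != y -> a x y},
      forall x y, x \in Q -> y \notin Q -> a x y -> t < #|nbr a y|,
      2 * \sum_(y in ~: Q) #|nbr a y :&: Q| <= t
    & forall y, y \notin Q -> #|nbr a y :&: Q| <= l].

Lemma light_nbr l Q y : light l Q -> y \notin Q -> 2 * #|nbr a y :&: Q| <= t.
Proof.
move=> [_ _ _ s _] yQ; apply: leq_trans s; rewrite leq_mul2l /=.
by rewrite (bigD1 y) ?inE //= leq_addr.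
Qed.

Lemma light_card l Q D : light l Q -> 0 < l ->
  {in D, forall y, y \notin Q /\ #|nbr a y :&: Q| = l} -> 2 * #|D| <= t.
Proof.
move=> [_ _ _ s _] l0 HD; apply: leq_trans s; rewrite leq_mul2l /=.
rewrite -sum1_card [leqRHS](big_setID D) /= (_ : ~: Q :&: D = D); last first.
  by apply/setIidPr/subsetP => y /HD [yQ _]; rewrite inE.
apply: leq_trans (leq_addr _ _); apply: leq_sum => y /HD [_ ->] //.
Qed.

Lemma light_deg l Q y : light l Q -> y \notin Q -> 0 < #|nbr a y :&: Q| ->
  t < #|nbr a y|.
Proof.
move=> [_ _ d _ _] yQ; rewrite card_gt0 => /set0Pn [x /setIP [ayx xQ]].
by apply: (d x y) => //; rewrite sa; rewrite in_nbr in ayx.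
Qed.

Definition level_set Q Q' N : {set V} :=
  [set y in ~: (Q :|: Q') | nbr a y :&: Q == N].

Section Pair.
Variables (l : nat) (Q1 Q2 : {set V}).
Hypotheses (L1 : light l Q1) (L2 : light l Q2).
Hypothesis dQ : [disjoint Q1 & Q2].
Let A := ~: (Q1 :|: Q2).
Let p y := #|nbr a y :&: Q1|.
Let q y := #|nbr a y :&: Q2|.

Lemma outside_notin y : y \in A -> y \notin Q1 /\ y \notin Q2.
Proof. by rewrite !inE negb_or => /andP. Qed.

(** Fusing with full prefixes, of length [p z + q z], loses no triangles and keeps the number of
    edges from outside to the cliques. An edge between the cliques would disappear, against
    extremality. *)
Lemma cross_free x y : x \in Q1 -> y \in Q2 -> ~~ a x y.
Proof.
move=> x1 y2; apply/negP => axy; have [c1 k1 _ _ _] := L1; have [c2 k2 _ _ _] := L2.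
pose ka z := p z + q z.
have bka : {in A, forall z, ka z <= t.+1}.
  move=> z zA; have [z1 z2] := outside_notin zA.
  by have := light_nbr L1 z1; have := light_nbr L2 z2; rewrite /ka /p /q; lia.
have := @arcs_fuse_le _ a Q1 Q2 t sa dQ c1 c2 k1 k2 ka bka.
have -> : [exists x in Q1, exists y in Q2, a x y].
  by apply/existsP; exists x; rewrite x1; apply/existsP; exists y; rewrite y2.
suff : arcs a <= arcs (fuse a Q1 Q2 ka) by rewrite /ka /p /q; lia.
apply: exta; [exact: fuse_sym|exact: fuse_irrefl|].
move=> v; have [vA|vA] := boolP (v \in A); last exact: tau_fuse_clique.
rewrite -[tau _ v]addn0; apply: leq_trans (adma v) _.
apply: (tau_le_fuse sa dQ c1 bka vA).
rewrite addn0; apply: leq_add.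
  rewrite leq_mul2l; apply: leq_sum => z _; rewrite /ka /p /q.
  have := subset_leq_card (subsetIl (nbr a v :&: Q1) (nbr a z :&: Q1)).
  have := subset_leq_card (subsetIr (nbr a v :&: Q1) (nbr a z :&: Q1)).
  have := subset_leq_card (subsetIl (nbr a v :&: Q2) (nbr a z :&: Q2)).
  have := subset_leq_card (subsetIr (nbr a v :&: Q2) (nbr a z :&: Q2)).
  lia.
by apply: leq_trans (sum_nbr_le ia _) _; rewrite cardD_A.
Qed.

End Pair.

Section Fuse.
Variables (l : nat) (Q1 Q2 : {set V}).
Hypotheses (L1 : light l Q1) (L2 : light l Q2) (dQ : [disjoint Q1 & Q2]).
Let A := ~: (Q1 :|: Q2).
Let p y := #|nbr a y :&: Q1|.
Let q y := #|nbr a y :&: Q2|.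
Variable ka : V -> nat.
Hypothesis leka : {in A, forall y, ka y <= p y + q y}.

Lemma fuse_bound : {in A, forall y, ka y <= t.+1}.
Proof.
move=> y yA; have [y1 y2] := outside_notin yA; apply: leq_trans (leka yA) _.
by have := light_nbr L1 y1; have := light_nbr L2 y2; rewrite /p /q; clear; lia.
Qed.

(** The term [D :&: nbr a y] bounds the loss of triangles with one vertex in the cliques, and [s]
    the loss of those with two. *)
Lemma tau_fuse_loss D y s : y \in A ->
  {in A, forall x, #|nbr a y :&: Q1 :&: (nbr a x :&: Q1)| +
       #|nbr a y :&: Q2 :&: (nbr a x :&: Q2)| <=
       minn (ka y) (ka x) + (x \in D)} ->
  p y * (p y).-1 + q y * (q y).-1 <= ka y * (ka y).-1 + 2 * s ->
  tau a y <= tau (fuse a Q1 Q2 ka) y + 2 * (#|D :&: nbr a y| + s).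
Proof.
move=> yA le inner; have [c1 _ _ _ _] := L1.
apply: (tau_le_fuse sa dQ c1 fuse_bound yA).
have noncross := cross_free L1 L2 dQ.
apply: leq_trans (leq_add (leqnn _) (sum_nbr_cliques sa ia dQ noncross y)) _.
have : \sum_(x in nbr a y :&: A)
      (#|nbr a y :&: Q1 :&: (nbr a x :&: Q1)| +
       #|nbr a y :&: Q2 :&: (nbr a x :&: Q2)|) <=
      \sum_(x in nbr a y :&: A) minn (ka y) (ka x) + #|D :&: nbr a y|.
  apply: leq_trans (_ : _ <= \sum_(x in nbr a y :&: A)
       (minn (ka y) (ka x) + (x \in D))) _.
    by apply: leq_sum => x /setIP [_ xA]; apply: le.
  rewrite big_split /= sum_mem leq_add2l subset_leq_card //.
  by apply/subsetP => x /setIP [/setIP [xy _] xD]; rewrite in_setI xD.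
move: inner; rewrite /p /q.
move: (\sum_(x in _) _) (\sum_(x in _) _) => s1 s2.
by move: (_ * _.-1) (_ * _.-1) (_ * _.-1) #|D :&: _|; clear; lia.
Qed.

(** This is extremality as used below: a repair of the fused graph must add at least as many edges
    as were dropped. *)
Lemma fuse_extremal (b : rel V) k :
  symmetric b -> irreflexive b -> (forall v, t * t.-1 <= tau b v) ->
  arcs b <= arcs (fuse a Q1 Q2 ka) + 2 * k ->
  \sum_(x in A) (p x + q x) <= \sum_(x in A) ka x + k.
Proof.
move=> sb ib tb; have [c1 k1 _ _ _] := L1; have [c2 k2 _ _ _] := L2.
have := arcs_fuse_le sa dQ c1 c2 k1 k2 fuse_bound.
have := exta sb ib tb; rewrite -/A /p /q.
move: (\sum_(x in A) _) (\sum_(x in A) _) => s1 s2.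
by move: (arcs _) (arcs _) (arcs _) (nat_of_bool _) => *; lia.
Qed.

End Fuse.

(* Drop one neighbour of each vertex of the level set, and join b to those not adjacent
to b: the new triangles through b, and through the first l - 1 vertices of Q1,
reduce the deficit to the level vertices adjacent to b. *)
Lemma drop_one l Q1 Q2 N b : 0 < l -> light l Q1 -> light l Q2 ->
  [disjoint Q1 & Q2] -> #|N| = l ->
  b \in ~: (Q1 :|: Q2) -> b \notin level_set Q1 Q2 N ->
  l <= #|nbr a b :&: Q1| + #|nbr a b :&: Q2| ->
  (exists2 y, y \in level_set Q1 Q2 N & a b y) ->
  #|nbr a b :&: Q1| = 0 \/
    {in level_set Q1 Q2 N, forall y, a b y -> 0 < #|nbr a y :&: Q2|} -> False.
Proof.
move=> l0 L1 L2 dQ cN bA bD lb [y0 y0D aby0] cases.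
have [c1 k1 _ _ v1] := L1; have [c2 k2 _ _ v2] := L2.
set D := level_set Q1 Q2 N in bD y0D cases *.
pose A := ~: (Q1 :|: Q2); pose p y := #|nbr a y :&: Q1|.
pose q y := #|nbr a y :&: Q2|; pose ka z := p z + q z - (z \in D).
have DA y : y \in D -> y \in A by rewrite inE => /andP [].
have Dp y : y \in D -> p y = l by rewrite inE /p => /andP [_ /eqP ->].
have DE y : y \in A -> (y \in D) = (nbr a y :&: Q1 == N).
  by rewrite [y \in D]inE => ->.
have Dl : {in D, forall y, y \notin Q1 /\ #|nbr a y :&: Q1| = l}.
  by move=> y yD; have [y1 _] := outside_notin (DA _ yD); split=> //; apply: Dp.
have pq z : z \in A -> [/\ 2 * p z <= t, 2 * q z <= t & p z <= l].
  move=> zA; have [z1 z2] := outside_notin zA.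
  by rewrite (light_nbr L1 z1) (light_nbr L2 z2) v1.
have leka : {in A, forall y, ka y <= p y + q y}.
  by move=> y _; apply: leq_subr.
have bka := fuse_bound L1 L2 leka.
have noncross := cross_free L1 L2 dQ.
set m := fuse a Q1 Q2 ka.
have sm : symmetric m by apply: fuse_sym.
have im : irreflexive m by apply: fuse_irrefl.
have mA x y : x \in A -> y \in A -> m x y = a x y by apply: fuseA.
have ptw y x : y \in A -> x \in A ->
    #|nbr a y :&: Q1 :&: (nbr a x :&: Q1)| +
    #|nbr a y :&: Q2 :&: (nbr a x :&: Q2)|
    <= minn (ka y) (ka x) + ((y \in D) && (x \in D)).
  move=> yA xA; have [_ _ lpy] := pq y yA; have [_ _ lpx] := pq x xA.
  have := setI_level cN lpy lpx; rewrite -!DE //.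
  have := subset_leq_card (subsetIl (nbr a y :&: Q2) (nbr a x :&: Q2)).
  have := subset_leq_card (subsetIr (nbr a y :&: Q2) (nbr a x :&: Q2)).
  have : p y = l \/ y \notin D by case yD: (y \in D); [left; apply: Dp|right].
  have : p x = l \/ x \notin D by case xD: (x \in D); [left; apply: Dp|right].
  rewrite /ka /p /q; clear -l0; case: (y \in D); case: (x \in D) => /=; lia.
have inner y : y \in A ->
    \sum_(x in nbr a y :\: A) #|(nbr a y :\: A) :&: nbr a x| <=
    p y * (p y).-1 + q y * (q y).-1.
  by move=> _; apply: sum_nbr_cliques.
(* If [q y = 0], the prefix shrinks from [l] to [l - 1] vertices and [l - 1] pairs inside it are
   lost. If [q y > 0], merging both traces into one prefix makes up for the dropped vertex. *)
have tauD y : y \in D ->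
    tau a y <= tau m y + 2 * (#|D :&: nbr a y| + (q y == 0) * l.-1).
  move=> yD; have yA := DA _ yD; apply: (tau_fuse_loss L1 L2 dQ leka yA).
    by move=> x xA; have := ptw _ _ yA xA; rewrite yD.
  rewrite /ka -/(p y) -/(q y) (Dp _ yD) yD.
  by move: (q y) l0 => k; clear; case: k => [|k] /=; nia.
have tauO y : y \in A -> y \notin D -> tau a y <= tau m y.
  move=> yA /negbTE yD.
  have := @tau_fuse_loss l Q1 Q2 L1 L2 dQ ka leka set0 y 0 yA.
  rewrite set0I cards0 muln0 !addn0; apply=> [x xA|].
    by have := ptw _ _ yA xA; rewrite in_set0 yD.
  by rewrite /ka yD subn0 pronic_add.
(* In [a] the vertices [y] and [b] share nothing in the cliques, but after fusing they share the
   first [l - 1] vertices of [Q1]. This offsets the lost pairs. *)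
have tauB y : y \in D -> a y b -> p b = 0 -> q y = 0 ->
    tau a y <= tau m y + 2 * #|D :&: nbr a y|.
  move=> yD ayb pb qy; have yA := DA _ yD.
  apply: (tau_le_fuse sa dQ c1 bka yA).
  apply: leq_trans (leq_add (leqnn _) (inner y yA)) _.
  have : \sum_(x in nbr a y :&: A)
      (#|nbr a y :&: Q1 :&: (nbr a x :&: Q1)| +
       #|nbr a y :&: Q2 :&: (nbr a x :&: Q2)|) + l.-1 <=
      \sum_(x in nbr a y :&: A) minn (ka y) (ka x) + #|D :&: nbr a y|.
    have -> : l.-1 = \sum_(x in nbr a y :&: A) (x \in [set b]) * l.-1.
      rewrite -big_distrl /= sum_mem (setIidPr _) ?cards1 ?mul1n //.
      by rewrite sub1set in_setI in_nbr ayb.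
    rewrite -big_split /=.
    apply: leq_trans (_ : _ <= \sum_(x in nbr a y :&: A)
       (minn (ka y) (ka x) + (x \in D))) _.
      apply: leq_sum => x /setIP [_ xA]; rewrite inE.
      have [-> {xA}|_] := eqVneq x b; last first.
        by rewrite addn0; have := ptw _ _ yA xA; rewrite yD.
      have := subset_leq_card (subsetIr (nbr a y :&: Q1) (nbr a b :&: Q1)).
      have := subset_leq_card (subsetIl (nbr a y :&: Q2) (nbr a b :&: Q2)).
      rewrite -/(p b) -/(q y) pb qy !leqn0 => /eqP -> /eqP ->.
      by move: lb; rewrite -/(p b) -/(q b) /ka (Dp _ yD) qy yD (negbTE bD) pb; clear; lia.
    rewrite big_split /= sum_mem leq_add2l subset_leq_card //.
    by apply/subsetP => x /setIP [/setIP [xy _] xD]; rewrite in_setI xD.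
  rewrite (Dp _ yD) [ka y in X in _ -> _ <= _ + X + _]/ka (Dp _ yD) yD qy.
  move: (\sum_(x in _) _) (\sum_(x in _) _) => s1 s2.
  by move: (#|_|) l0 => d; clear; nia.
have m1 z w : z \in A -> w \in Q1 -> m z w = (index w (enum Q1) < ka z).
  by move=> zA w1; rewrite /m fuse1.
have mcl z : z \notin A -> t * t.-1 <= tau m z by apply: tau_fuse_clique.
have mdeg z : z \in A -> #|nbr m z| = #|nbr a z :&: A| + ka z.
  by move=> zA; rewrite /m (deg_fuse a c1 bka zA).
have mext := fuse_extremal L1 L2 dQ leka.
rewrite -/m -/A in mext; clearbody m.
pose E := setX [set b] (D :\: nbr a b); pose m' := add_edges m E.
have bA' : b \in A by [].
have sm' : symmetric m' by apply: add_sym.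
have im' : irreflexive m'.
  apply: add_irrefl => // x; rewrite in_setX in_set1 in_setD.
  by apply/negP => /= /and3P [/eqP -> _]; apply/negP.
have sub : subrel m m' by apply: add_sub.
have m'b y : y \in D -> m' y b.
  move=> yD; have [aby|naby] := boolP (a b y).
    by apply: sub; rewrite (mA _ _ (DA _ yD) bA) sa.
  by rewrite /m' /add_edges /= !in_setX /= !in_set1 !in_setD !in_nbr eqxx naby yD !orbT.
have m'arcs : arcs m' <= arcs m + 2 * #|D :\: nbr a b|.
  by apply: leq_trans (arcs_add _ _) _; rewrite cardsX cards1 mul1n.
clearbody m'; clear E.
(* Both [b] and all of [D] see these [l - 1] vertices, so a new edge from [b] to a vertex of [D]
   closes a triangle with each of them. *)
pose W1 := [set w in Q1 | index w (enum Q1) < l.-1].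
have cW1 : #|W1| = l.-1.
  have := v1 y0; have := Dp _ y0D; have [? _] := outside_notin (DA _ y0D).
  have := subset_leq_card (subsetIr (nbr a y0) Q1); rewrite /p => le e _.
  by apply: card_index_lt; rewrite e in le; move: le; clear; lia.
(* Only [T] still has a deficit. Its repair costs |T| - 1 edges, so that |D| - 1 edges in all
   replace the |D| dropped ones. *)
pose T := D :&: nbr a b.
have [c [sc ic tc cc]] : exists c : rel V, [/\ symmetric c, irreflexive c,
    forall v, t * t.-1 <= tau c v & arcs c <= arcs m' + 2 * #|T|.-1].
  apply: repair_deficit => //.
  - by apply/set0Pn; exists y0; rewrite in_setI y0D in_nbr.
  - have := light_card L1 l0 Dl; have := subset_leq_card (subsetIl D (nbr a b)).
    by rewrite -/T; clear; lia.
  - move=> z zT; have [zA|zA] := boolP (z \in A); last first.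
      by apply: leq_trans (tau_mono _ sub); apply: mcl.
    have [zD|zD] := boolP (z \in D); last first.
      apply: leq_trans (tau_mono _ sub).
      exact: leq_trans (adma z) (tauO _ zA zD).
    have naz : ~~ a b z by apply: contra zT => abz; rewrite in_setI zD in_nbr.
    apply: leq_trans (adma z) _; apply: leq_trans (tauD _ zD) _.
    apply: leq_trans (_ : _ <= tau m z + 2 * #|(D :&: nbr a z) :|: W1|) _.
      rewrite leq_add2l leq_mul2l /= cardsU (_ : _ :&: W1 = set0).
        by rewrite cards0 subn0 leq_add2l cW1; case: (q z == 0); rewrite ?mul1n.
      apply/setP => x; rewrite in_setI in_setI in_set0; apply/negP.
      case/andP => /andP [/DA xA _]; rewrite in_set => /andP [x1 _].
      by rewrite (mem1A _ x1) in xA.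
    apply: (@tau_gain _ m m' z b) => //; first exact: m'b.
    move=> x; rewrite in_setU (mA z b) // (sa z b) (negbTE naz) /=.
    case/orP => [/setIP [xD]|]; last rewrite in_set => /andP [x1 ix].
      rewrite in_nbr => azx; split=> //; last exact: m'b.
      by apply: sub; rewrite (mA _ _ zA (DA _ xD)).
    split=> //; apply: sub; last rewrite sm.
      rewrite m1 //; apply: leq_trans ix _.
      by rewrite /ka (Dp _ zD) zD; clear; lia.
    rewrite m1 //; apply: leq_trans ix _.
    by move: lb; rewrite /ka /p /q (negbTE bD); clear; lia.
  move=> z /setIP [zD]; rewrite in_nbr => abz; have zA := DA _ zD.
  have nsub : nbr m z \subset nbr m' z.
    by apply/subsetP => x; rewrite !in_nbr; apply: sub.
  split; last first.
    apply: leq_trans (subset_leq_card nsub); rewrite (mdeg _ zA).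
    have [z1 _] := outside_notin zA.
    have := light_deg L1 z1; rewrite -/(p z) (Dp _ zD) => /(_ l0).
    rewrite (nbr_split a dQ) -/(p z) -/(q z) /ka zD -/A /=; clear; lia.
  apply: leq_trans (adma z) _.
  apply: leq_trans (_ : _ <= tau m z + 2 * #|D :&: nbr a z|) _.
    case: cases => [pb|q0]; last first.
      have qz : (q z == 0) = false by apply/negbTE; rewrite -lt0n q0.
      by have := tauD _ zD; rewrite qz addn0.
    have [qz|qz] := eqVneq (q z) 0; first by apply: tauB; rewrite // sa.
    by have := tauD _ zD; rewrite (negbTE qz) addn0.
  rewrite -(cardsID (nbr a b) (D :&: nbr a z)) mulnDr [_ + 2 * _]addnC addnA.
  apply: leq_add; last first.
    rewrite leq_mul2l /=; apply: subset_leq_card; apply/subsetP => x.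
    rewrite !in_setI => /andP [/andP [xD]]; rewrite in_nbr => azx ->.
    by rewrite xD !andbT in_nbr; apply: sub; rewrite (mA _ _ zA (DA _ xD)).
  apply: (@tau_gain _ m m' z b) => //; first exact: m'b.
  move=> x; rewrite in_setD in_setI !in_nbr => /and3P [nabx xD azx].
  rewrite (mA _ _ (DA _ xD) bA) [a x b]sa (negbTE nabx) andbF.
  by split=> //; [apply: sub; rewrite (mA _ _ zA (DA _ xD))|apply: m'b].
have := mext c #|D|.-1 sc ic tc.
have -> : \sum_(x in A) (#|nbr a x :&: Q1| + #|nbr a x :&: Q2|) =
    \sum_(x in A) ka x + #|D|.
  rewrite -[#|D|](_ : #|A :&: D| = _); last first.
    by congr #|pred_of_set _|; apply/setIidPr/subsetP => x /DA.
  rewrite -sum_mem -big_split /=; apply: eq_bigr => x xA.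
  rewrite /ka /p /q; case xD: (x \in D); rewrite ?subn0 ?addn0 //.
  by have := Dp _ xD; rewrite /p => ->; move: l0; clear; lia.
rewrite leq_add2l; have := cardsID (nbr a b) D; rewrite -/T.
have : 0 < #|T|.
  by rewrite card_gt0; apply/set0Pn; exists y0; rewrite in_setI y0D in_nbr.
move: cc m'arcs; move: (arcs c) (arcs m) (arcs m') => ? ? ?.
by move: #|T| #|D| #|_ :\: _|; clear; lia.
Qed.

(** A vertex in both level sets trades two traces of size [l] for a prefix of length [2l - 1], which
    loses no pairs inside the cliques. The deficit is then of the form handled by [repair_deficit],
    at the cost of one edge fewer than were dropped. *)
Lemma drop_common l Q1 Q2 N1 N2 : 0 < l -> light l Q1 -> light l Q2 ->
  [disjoint Q1 & Q2] -> #|N1| = l -> #|N2| = l ->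
  level_set Q1 Q2 N1 :&: level_set Q2 Q1 N2 = set0.
Proof.
move=> l0 L1 L2 dQ cN1 cN2; apply/eqP; apply: contraT => /set0Pn D0.
have [c1 k1 _ _ v1] := L1; have [c2 k2 _ _ v2] := L2.
set D1 := level_set Q1 Q2 N1 in D0 *; set D2 := level_set Q2 Q1 N2 in D0 *.
pose A := ~: (Q1 :|: Q2); pose p y := #|nbr a y :&: Q1|.
pose q y := #|nbr a y :&: Q2|.
have D1E y : y \in A -> (y \in D1) = (nbr a y :&: Q1 == N1).
  by rewrite [y \in D1]inE => ->.
have D2E y : y \in A -> (y \in D2) = (nbr a y :&: Q2 == N2).
  by rewrite [y \in D2]inE setUC => ->.
have D1p y : y \in D1 -> p y = l by rewrite inE /p => /andP [_ /eqP ->].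
have D2q y : y \in D2 -> q y = l by rewrite inE /q => /andP [_ /eqP ->].
set D := D1 :&: D2 in D0; pose ka z := p z + q z - (z \in D).
have DA y : y \in D -> y \in A by rewrite inE => /andP []; rewrite inE => /andP [].
have leka : {in A, forall y, ka y <= p y + q y}.
  by move=> y _; apply: leq_subr.
have ptw y x : y \in A -> x \in A ->
    #|nbr a y :&: Q1 :&: (nbr a x :&: Q1)| +
    #|nbr a y :&: Q2 :&: (nbr a x :&: Q2)|
    <= minn (ka y) (ka x) + ((y \in D) && (x \in D)).
  move=> yA xA; have [y1 y2] := outside_notin yA; have [x1 x2] := outside_notin xA.
  have := setI_level cN1 (v1 _ y1) (v1 _ x1).
  have := setI_level cN2 (v2 _ y2) (v2 _ x2); rewrite -!D1E // -!D2E //.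
  have : p y = l \/ y \notin D1 by case yD: (y \in D1); [left; apply: D1p|right].
  have : p x = l \/ x \notin D1 by case xD: (x \in D1); [left; apply: D1p|right].
  have : q y = l \/ y \notin D2 by case yD: (y \in D2); [left; apply: D2q|right].
  have : q x = l \/ x \notin D2 by case xD: (x \in D2); [left; apply: D2q|right].
  rewrite /ka /D !in_setI -/(p y) -/(p x) -/(q y) -/(q x).
  move: l0; move: #|_ :&: (_ :&: Q1)| #|_ :&: (_ :&: Q2)| => u v; clear.
  move: (p y) (p x) (q y) (q x) => py px qy qx.
  by case: (y \in D1); case: (x \in D1); case: (y \in D2); case: (x \in D2) => /=;
     lia.
have tauD y : y \in D -> tau a y <= tau (fuse a Q1 Q2 ka) y + 2 * #|D :&: nbr a y|.
  move=> yD; have yA := DA _ yD; have /setIP [yD1 yD2] := yD.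
  have := @tau_fuse_loss l Q1 Q2 L1 L2 dQ ka leka D y 0 yA.
  rewrite muln0 !addn0; apply=> [x xA|]; first by have := ptw _ _ yA xA; rewrite yD.
  by rewrite /ka -/(p y) -/(q y) (D1p _ yD1) (D2q _ yD2) yD; move: l0; clear; nia.
have tauO y : y \in A -> y \notin D -> tau a y <= tau (fuse a Q1 Q2 ka) y.
  move=> yA /negbTE yD.
  have := @tau_fuse_loss l Q1 Q2 L1 L2 dQ ka leka set0 y 0 yA.
  rewrite set0I cards0 muln0 !addn0; apply=> [x xA|].
    by have := ptw _ _ yA xA; rewrite in_set0 yD.
  by rewrite /ka yD subn0 pronic_add.
have bka := fuse_bound L1 L2 leka.
have mext := fuse_extremal L1 L2 dQ leka.
have mA x y : x \in A -> y \in A -> fuse a Q1 Q2 ka x y = a x y by apply: fuseA.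
have [c [sc ic tc cc]] : exists c : rel V, [/\ symmetric c, irreflexive c,
    forall v, t * t.-1 <= tau c v
  & arcs c <= arcs (fuse a Q1 Q2 ka) + 2 * #|D|.-1].
  apply: repair_deficit; [exact: fuse_sym|exact: fuse_irrefl|exact/set0Pn| | | ].
  - have : 2 * #|D| <= t.
      apply: (light_card L1 l0) => y yD; have [y1 _] := outside_notin (DA _ yD).
      by split=> //; apply: D1p; case/setIP: yD.
    by clear; lia.
  - move=> z zD; have [zA|zA] := boolP (z \in A); last exact: tau_fuse_clique.
    exact: leq_trans (adma z) (tauO _ zA zD).
  move=> z zD; have zA := DA _ zD; split.
    apply: leq_trans (adma z) _; apply: leq_trans (tauD _ zD) _.
    rewrite leq_add2l leq_mul2l /=; apply: subset_leq_card.
    apply/subsetP => x /setIP [xD azx]; rewrite in_nbr in azx.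
    by rewrite in_setI xD in_nbr (mA _ _ zA (DA _ xD)) azx.
  rewrite (deg_fuse a c1 bka zA); have [z1 _] := outside_notin zA.
  have /setIP [zD1 _] := zD.
  have := light_deg L1 z1; rewrite -/(p z) (D1p _ zD1) => /(_ l0).
  by rewrite (nbr_split a dQ) -/(p z) -/(q z) /ka zD -/A /=; clear; lia.
have := mext c #|D|.-1 sc ic tc cc.
have -> : \sum_(x in ~: (Q1 :|: Q2)) (#|nbr a x :&: Q1| + #|nbr a x :&: Q2|) =
    \sum_(x in A) ka x + #|D|.
  rewrite -[#|D|](_ : #|A :&: D| = _); last first.
    by congr #|pred_of_set _|; apply/setIidPr/subsetP => x /DA.
  rewrite -sum_mem -big_split /=; apply: eq_bigr => x xA.
  rewrite /ka /p /q; case xD: (x \in D); rewrite ?subn0 ?addn0 //.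
  by have := D1p _ (setIP xD).1; rewrite /p => ->; move: l0; clear; lia.
rewrite leq_add2l; have : 0 < #|D| by rewrite card_gt0; apply/set0Pn.
by clear; lia.
Qed.

(* Without such an edge, both level sets drop one neighbour each, and a double
star joining y1 to the level set of y2 and y2 to that of y1 repairs all deficits
with one edge fewer than were dropped. *)
Lemma drop_both l Q1 Q2 N1 N2 : 0 < l -> light l Q1 -> light l Q2 ->
  [disjoint Q1 & Q2] -> #|N1| = l -> #|N2| = l ->
  level_set Q1 Q2 N1 != set0 -> level_set Q2 Q1 N2 != set0 ->
  exists y z, [/\ y \in level_set Q1 Q2 N1, z \in level_set Q2 Q1 N2 & a y z].
Proof.
move=> l0 L1 L2 dQ cN1 cN2 /set0Pn [y1 y1D] /set0Pn [y2 y2D].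
have D12 := drop_common l0 L1 L2 dQ cN1 cN2.
have [c1 k1 _ _ v1] := L1; have [c2 k2 _ _ v2] := L2.
set D1 := level_set Q1 Q2 N1 in y1D D12 *.
set D2 := level_set Q2 Q1 N2 in y2D D12 *.
have [/existsP [y /existsP [z /and3P [yD zD ayz]]]|nedge] :=
  boolP [exists y, exists z, [&& y \in D1, z \in D2 & a y z]]; first by exists y, z.
have noedge y z : y \in D1 -> z \in D2 -> a y z = false.
  move=> yD zD; apply/negbTE; apply: contra nedge => ayz.
  by apply/existsP; exists y; apply/existsP; exists z; rewrite yD zD.
exfalso; clear nedge.
pose A := ~: (Q1 :|: Q2); pose p y := #|nbr a y :&: Q1|.
pose q y := #|nbr a y :&: Q2|.
have D1E y : y \in A -> (y \in D1) = (nbr a y :&: Q1 == N1).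
  by rewrite [y \in D1]inE => ->.
have D2E y : y \in A -> (y \in D2) = (nbr a y :&: Q2 == N2).
  by rewrite [y \in D2]inE setUC => ->.
have D1p y : y \in D1 -> p y = l by rewrite inE /p => /andP [_ /eqP ->].
have D2q y : y \in D2 -> q y = l by rewrite inE /q => /andP [_ /eqP ->].
have D1A y : y \in D1 -> y \in A by rewrite inE => /andP [].
have D2A y : y \in D2 -> y \in A by rewrite inE setUC => /andP [].
have D1n2 y : y \in D1 -> (y \in D2) = false.
  by move=> yD; apply/negP => yD2; have := in_set0 y; rewrite -D12 in_setI yD yD2.
have D2n1 y : y \in D2 -> (y \in D1) = false.
  by move=> yD; apply/negP => /D1n2; rewrite yD.
pose ka z := p z + q z - (z \in D1) - (z \in D2).
have leka : {in A, forall y, ka y <= p y + q y}.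
  by move=> y _; rewrite /ka; clear; lia.
have ptw y x : y \in A -> x \in A ->
    #|nbr a y :&: Q1 :&: (nbr a x :&: Q1)| +
    #|nbr a y :&: Q2 :&: (nbr a x :&: Q2)|
    <= minn (ka y) (ka x) + ((y \in D1) && (x \in D1))
       + ((y \in D2) && (x \in D2)).
  move=> yA xA; have [yQ1 yQ2] := outside_notin yA; have [xQ1 xQ2] := outside_notin xA.
  have := setI_level cN1 (v1 _ yQ1) (v1 _ xQ1).
  have := setI_level cN2 (v2 _ yQ2) (v2 _ xQ2); rewrite -!D1E // -!D2E //.
  have : p y = l \/ y \notin D1 by case yD: (y \in D1); [left; apply: D1p|right].
  have : p x = l \/ x \notin D1 by case xD: (x \in D1); [left; apply: D1p|right].
  have : q y = l \/ y \notin D2 by case yD: (y \in D2); [left; apply: D2q|right].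
  have : q x = l \/ x \notin D2 by case xD: (x \in D2); [left; apply: D2q|right].
  have : ~~ ((y \in D1) && (y \in D2)) by rewrite -in_setI D12 in_set0.
  have : ~~ ((x \in D1) && (x \in D2)) by rewrite -in_setI D12 in_set0.
  rewrite /ka -/(p y) -/(p x) -/(q y) -/(q x).
  move: l0; move: #|_ :&: (_ :&: Q1)| #|_ :&: (_ :&: Q2)| => u v; clear.
  move: (p y) (p x) (q y) (q x) => py px qy qx.
  by case: (y \in D1); case: (x \in D1); case: (y \in D2); case: (x \in D2) => //=;
     lia.
pose m := fuse a Q1 Q2 ka.
have tauO y : y \in A -> y \notin D1 -> y \notin D2 -> tau a y <= tau m y.
  move=> yA /negbTE yD1 /negbTE yD2.
  have := @tau_fuse_loss l Q1 Q2 L1 L2 dQ ka leka set0 y 0 yA.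
  rewrite set0I cards0 muln0 !addn0; apply=> [x xA|].
    by have := ptw _ _ yA xA; rewrite in_set0 yD1 yD2 addn0.
  by rewrite /ka yD1 yD2 !subn0 pronic_add.
have tau1 y : y \in D1 -> tau a y <= tau m y + 2 * (#|D1 :&: nbr a y| + l.-1).
  move=> yD; have yA := D1A _ yD; apply: (tau_fuse_loss L1 L2 dQ leka yA).
    by move=> x xA; have := ptw _ _ yA xA; rewrite yD D1n2 // addn0.
  rewrite /ka -/(p y) -/(q y) (D1p _ yD) yD D1n2 // subn0.
  by move: (q y) l0 => k; clear; case: k => [|k] /=; nia.
have tau2 y : y \in D2 -> tau a y <= tau m y + 2 * (#|D2 :&: nbr a y| + l.-1).
  move=> yD; have yA := D2A _ yD; apply: (tau_fuse_loss L1 L2 dQ leka yA).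
    by move=> x xA; have := ptw _ _ yA xA; rewrite yD D2n1 // addn0.
  rewrite /ka -/(p y) -/(q y) (D2q _ yD) yD D2n1 // subn0.
  by move: (p y) l0 => k; clear; case: k => [|k] /=; nia.
have bka := fuse_bound L1 L2 leka.
have mext := fuse_extremal L1 L2 dQ leka.
have mA x y : x \in A -> y \in A -> m x y = a x y by apply: fuseA.
have m1 z w : z \in A -> w \in Q1 -> m z w = (index w (enum Q1) < ka z).
  by move=> zA w1; rewrite /m fuse1.
have mcl z : z \notin A -> t * t.-1 <= tau m z by apply: tau_fuse_clique.
have sm : symmetric m by apply: fuse_sym.
have im : irreflexive m by apply: fuse_irrefl.
rewrite -/m -/A in mext; clearbody m.
(* The second star omits [y1], which the first star already joins to [y2]; this is the edge
   saved. *)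
pose E := setX [set y1] D2 :|: setX [set y2] (D1 :\ y1).
have cE : #|E| <= (#|D1| + #|D2|).-1.
  apply: leq_trans (leq_card_setU _ _) _; rewrite !cardsX !cards1.
  by have := cardsD1 y1 D1; rewrite y1D; clear; lia.
pose m' := add_edges m E.
have sm' : symmetric m' by apply: add_sym.
have im' : irreflexive m'.
  apply: add_irrefl => // x; rewrite in_setU !in_setX !in_set1 in_setD1 /=.
  apply/negP => /orP [/andP [/eqP -> ]|/and3P [/eqP -> _]].
    by rewrite D1n2.
  by rewrite D2n1.
have sub : subrel m m' by apply: add_sub.
have m'1 y : y \in D2 -> m' y y1.
  move=> yD; rewrite /m' /add_edges /= !in_setU !in_setX /= !in_set1 eqxx yD.
  by rewrite !orbT.
have m'2 y : y \in D1 -> m' y y2.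
  move=> yD; have [->|ne] := eqVneq y y1; first by rewrite sm' m'1.
  rewrite /m' /add_edges /= !in_setU !in_setX /= !in_set1 !in_setD1 ne yD eqxx.
  by rewrite !orbT.
have m'arcs : arcs m' <= arcs m + 2 * (#|D1| + #|D2|).-1.
  by apply: leq_trans (arcs_add _ _) _; rewrite leq_add2l leq_mul2l /= cE.
clearbody m'; clear cE E.
pose W1 := [set w in Q1 | index w (enum Q1) < l.-1].
have [y1Q _] := outside_notin (D1A _ y1D).
have cW1 : #|W1| = l.-1.
  have := D1p _ y1D; have := subset_leq_card (subsetIr (nbr a y1) Q1).
  by rewrite /p => le e; apply: card_index_lt; rewrite e in le; move: le; clear; lia.
(* The new edge from [z] to the centre [c] closes triangles with the neighbours of [z] in [D] and
   with [W1], which matches the losses in [tau1] and [tau2]. *)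
have gain D z c : {in D, forall y, y \in A /\ m' y c} -> z \in D -> c \in A ->
    ~~ a z c -> l.-1 <= ka z -> l.-1 <= ka c ->
    tau m z + 2 * (#|D :&: nbr a z| + l.-1) <= tau m' z.
  move=> HD zD cA nazc lz lc; have [zA mzc] := HD _ zD.
  have -> : #|D :&: nbr a z| + l.-1 = #|(D :&: nbr a z) :|: W1|.
    rewrite cardsU (_ : _ :&: W1 = set0) ?cards0 ?subn0 ?cW1 //.
    apply/setP => x; rewrite in_setI in_setI in_set0; apply/negP.
    case/andP => /andP [/HD [xA _] _]; rewrite in_set => /andP [x1 _].
    by rewrite (mem1A _ x1) in xA.
  apply: (@tau_gain _ m m' z c) => //.
  move=> x; rewrite in_setU (mA z c) // (negbTE nazc) /=.
  case/orP => [/setIP [xD]|]; last rewrite in_set => /andP [x1 ix].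
    have [xA mxc] := HD _ xD; rewrite in_nbr => azx; split=> //.
    by apply: sub; rewrite mA.
  by split=> //; apply: sub; [|rewrite sm]; rewrite m1 //; apply: leq_trans ix _.
have ka1 z : z \in D1 -> l.-1 <= ka z.
  by move=> zD; rewrite /ka (D1p _ zD) zD D1n2 //; clear; lia.
have ka2 z : z \in D2 -> l.-1 <= ka z.
  by move=> zD; rewrite /ka (D2q _ zD) zD D2n1 //; clear; lia.
have tm' v : t * t.-1 <= tau m' v.
  have [vA|vA] := boolP (v \in A); last first.
    by apply: leq_trans (tau_mono _ sub); apply: mcl.
  apply: leq_trans (adma v) _.
  have [vD1|vD1] := boolP (v \in D1).
    apply: leq_trans (tau1 _ vD1) _; apply: (gain _ _ y2) => //.
    - by move=> y yD; split; [apply: D1A|apply: m'2].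
    - exact: D2A.
    - by rewrite noedge.
    - exact: ka1.
    - exact: ka2.
  have [vD2|vD2] := boolP (v \in D2).
    apply: leq_trans (tau2 _ vD2) _; apply: (gain _ _ y1) => //.
    - by move=> y yD; split; [apply: D2A|apply: m'1].
    - exact: D1A.
    - by rewrite sa noedge.
    - exact: ka2.
    - exact: ka1.
  by apply: leq_trans (tauO _ vA vD1 vD2) _; apply: tau_mono.
have := mext m' (#|D1| + #|D2|).-1 sm' im' tm' m'arcs.
have -> : \sum_(x in A) (#|nbr a x :&: Q1| + #|nbr a x :&: Q2|) =
    \sum_(x in A) ka x + (#|D1| + #|D2|).
  rewrite -[#|D1|](_ : #|A :&: D1| = _); last first.
    by congr #|pred_of_set _|; apply/setIidPr/subsetP => x /D1A.
  rewrite -[#|D2|](_ : #|A :&: D2| = _); last first.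
    by congr #|pred_of_set _|; apply/setIidPr/subsetP => x /D2A.
  rewrite -!sum_mem -!big_split /=; apply: eq_bigr => x xA.
  rewrite /ka -/(p x) -/(q x); have [xD1|xD1] := boolP (x \in D1).
    by rewrite (D1n2 _ xD1) (D1p _ xD1); move: l0; clear; lia.
  have [xD2|xD2] := boolP (x \in D2); last by rewrite !subn0 !addn0.
  by rewrite (D2q _ xD2); move: l0; clear; lia.
rewrite leq_add2l; have : 0 < #|D1| by rewrite card_gt0; apply/set0Pn; exists y1.
by clear; lia.
Qed.

(** By [drop_both] some edge joins the two level sets. If a vertex of [D2] with a neighbour in [D1]
    sees nothing of [Q1], it serves as [b] for dropping at [D1]. Otherwise all such vertices see
    [Q1], which is the alternative required for dropping at [D2] with [b] in [D1]. *)
Lemma two_lights l Q1 Q2 : 0 < l -> light l Q1 -> light l Q2 ->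
  [disjoint Q1 & Q2] ->
  (exists2 y, y \notin Q1 & #|nbr a y :&: Q1| = l) ->
  (exists2 y, y \notin Q2 & #|nbr a y :&: Q2| = l) -> False.
Proof.
move=> l0 L1 L2 dQ [y1 y1Q e1] [y2 y2Q e2].
have dQ' : [disjoint Q2 & Q1] by rewrite disjoint_sym.
have noncross := cross_free L1 L2 dQ.
have out1 : y1 \notin Q2.
  apply/negP => y1Q2; move: l0; rewrite -e1 card_gt0 => /set0Pn [x /setIP [ayx xQ1]].
  by have := noncross _ _ xQ1 y1Q2; rewrite sa; rewrite in_nbr in ayx; rewrite ayx.
have out2 : y2 \notin Q1.
  apply/negP => y2Q1; move: l0; rewrite -e2 card_gt0 => /set0Pn [x /setIP [ayx xQ2]].
  by have := noncross _ _ y2Q1 xQ2; rewrite in_nbr in ayx; rewrite ayx.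
pose N1 := nbr a y1 :&: Q1; pose N2 := nbr a y2 :&: Q2.
pose D1 := level_set Q1 Q2 N1; pose D2 := level_set Q2 Q1 N2.
have y1D : y1 \in D1 by rewrite inE /N1 eqxx inE in_setU negb_or y1Q out1.
have y2D : y2 \in D2 by rewrite inE /N2 eqxx inE in_setU negb_or y2Q out2.
have [||y [z [yD zD ayz]]] := drop_both l0 L1 L2 dQ e1 e2.
- by apply/set0Pn; exists y1.
- by apply/set0Pn; exists y2.
have D12 : D1 :&: D2 = set0 := drop_common l0 L1 L2 dQ e1 e2.
have D1n2 x : x \in D1 -> x \notin D2.
  by move=> xD; apply/negP => xD2; have := in_set0 x; rewrite -D12 in_setI xD xD2.
have D2n1 x : x \in D2 -> x \notin D1.
  by move=> xD; apply/negP => /D1n2; rewrite xD.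
have [/existsP [b /existsP [x /and4P [bD xD abx pb]]]|npb] :=
    boolP [exists b, exists x,
      [&& b \in D2, x \in D1, a b x & #|nbr a b :&: Q1| == 0]].
  apply: (drop_one (b := b) l0 L1 L2 dQ e1) => //.
  - by move: bD; rewrite inE setUC => /andP [].
  - exact: D2n1.
  - by move: bD; rewrite inE => /andP [_ /eqP ->]; rewrite e2 leq_addl.
  - by exists x.
  - by left; apply/eqP.
apply: (drop_one (b := y) l0 L2 L1 dQ' e2) => //.
- by move: yD; rewrite inE setUC => /andP [].
- exact: D1n2.
- by move: yD; rewrite inE => /andP [_ /eqP ->]; rewrite e1 leq_addl.
- by exists z.
right=> b bD ayb; rewrite lt0n; apply: contra npb => pb.
by apply/existsP; exists b; apply/existsP; exists y; rewrite bD yD sa ayb.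
Qed.

End Lights.

(** * A comparison graph made of disjoint cliques *)

Section Blocks.
Variables (V : finType) (t : nat).
Hypothesis ltV : t < #|V|.
Implicit Types x y z : V.

Let idx x := index x (enum [set: V]).
Let blk x := idx x %/ t.+1.
Let q := #|V| %/ t.+1.

Definition block_rel : rel V :=
  [rel x y | [&& x != y, blk x == blk y & blk x < q]].

Definition block_extra : {set V * V} :=
  setX [set x | q <= blk x] [set y | idx y < t].

Definition block_graph := add_edges block_rel block_extra.

Lemma card_idx k : k <= #|V| -> #|[set x : V | idx x < k]| = k.
Proof.
rewrite -cardsT => /card_index_lt {2}<-; apply: eq_card => x.
by rewrite !inE.
Qed.

Lemma q_gt0 : 0 < q. Proof. by rewrite divn_gt0. Qed.

Lemma idx_blk0 x : idx x < t.+1 -> blk x = 0.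
Proof. exact: divn_small. Qed.

Lemma block_sym : symmetric block_rel.
Proof.
move=> x y; rewrite /block_rel /= eq_sym; case: eqVneq => //= _.
by rewrite eq_sym; case: eqP => // ->.
Qed.

Lemma block_irrefl : irreflexive block_rel.
Proof. by move=> x; rewrite /block_rel /= eqxx. Qed.

Lemma card_block k : k < q -> #|[set x | blk x == k]| = t.+1.
Proof.
move=> kq; have le : k.+1 * t.+1 <= #|V|.
  by apply: leq_trans (leq_divM _ t.+1); rewrite leq_mul2r kq orbT.
have e1 := card_idx le.
have e0 : #|[set x : V | idx x < k * t.+1]| = k * t.+1.
  by apply: card_idx; apply: leq_trans le; rewrite leq_mul2r leqnSn orbT.
rewrite (_ : [set x | blk x == k] =
    [set x | idx x < k.+1 * t.+1] :\: [set x : V | idx x < k * t.+1]).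
  rewrite cardsD (setIidPr _) ?e1 ?e0; first by rewrite mulSn addnK.
  by apply/subsetP => x; rewrite !inE => /leq_trans; apply;
     rewrite leq_mul2r leqnSn orbT.
by apply/setP => x; rewrite !inE -leqNgt -!ltn_divLR // -leq_divRL // -/(blk x)
  ltnS eqn_leq andbC.
Qed.

Lemma block_graph_irrefl : irreflexive block_graph.
Proof.
apply: (add_irrefl block_irrefl) => x; rewrite in_setX !inE /=; apply/negP => /andP [qx xt].
by move: qx; rewrite (idx_blk0 (ltnW xt)) leqNgt q_gt0.
Qed.

Lemma block_clique x : blk x < q ->
  {in [set y | blk y == blk x] &, forall y z, y != z -> block_rel y z}.
Proof.
move=> xq y z; rewrite !inE => /eqP ey /eqP ez yz.
by rewrite /block_rel /= yz ey ez eqxx.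
Qed.

Lemma block_graph_tau x : t * t.-1 <= tau block_graph x.
Proof.
have [xq|xq] := ltnP (blk x) q.
  apply: leq_trans (tau_mono _ (@add_sub _ _ block_extra)).
  have := cardsD1 x [set y | blk y == blk x].
  rewrite card_block // inE eqxx => -[ct]; rewrite {1 2}ct.
  apply: tau_clique.
    apply/subsetP => y /setD1P [yx yx']; rewrite in_nbr.
    by apply: (block_clique xq) => //; rewrite ?inE // eq_sym.
  by move=> y z /setD1P [_ yB] /setD1P [_ zB]; apply: (block_clique xq).
have ct : #|[set y : V | idx y < t]| = t by rewrite card_idx // ltnW.
rewrite -{1 2}ct; apply: tau_clique.
  apply/subsetP => y; rewrite inE in_nbr => yt.
  by rewrite /block_graph /add_edges /= !in_setX !inE /= xq yt !orbT.
move=> y z; rewrite !inE => yt zt yz; apply: add_sub.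
by rewrite /block_rel /= yz !idx_blk0 ?q_gt0 ?eqxx //; apply: ltnW.
Qed.

(** The r <= t leftover vertices contribute at most 2rt arcs, of which rt are covered by
    [#|V| * t]. *)
Lemma block_graph_arcs : arcs block_graph <= #|V| * t + t * t.
Proof.
apply: leq_trans (arcs_add _ _) _; rewrite cardsX arcs_deg.
have leqV : q * t.+1 <= #|V| by apply: leq_divM.
have e : [set x : V | blk x < q] = [set x | idx x < q * t.+1].
  by apply/setP => x; rewrite !inE /blk ltn_divLR.
have -> : \sum_x #|nbr block_rel x| = (q * t.+1) * t.
  rewrite -[q * t.+1](card_idx leqV) -e -sum_nat_const [RHS]big_mkcond /=.
  apply: eq_bigr => x _; rewrite inE; case: ltnP => [xq|qx]; last first.
    by apply: eq_card0 => y; rewrite in_nbr /block_rel /= ltnNge qx !andbF.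
  have := cardsD1 x [set y | blk y == blk x].
  rewrite card_block // inE eqxx => -[->]; apply: eq_card => y.
  rewrite in_setD1 inE in_nbr /block_rel /= xq andbT.
  by rewrite eq_sym [blk x == _]eq_sym.
rewrite card_idx; last exact: ltnW.
have -> : #|[set x | q <= blk x]| = #|V| - q * t.+1.
  rewrite -[q * t.+1](card_idx leqV) -e -(cardsC [set x | blk x < q]) addKn.
  apply: eq_card => x.
  by rewrite !inE -leqNgt.
have := divn_eq #|V| t.+1; have := ltn_pmod #|V| (ltn0Sn t); rewrite -/q.
by move: (_ %% _) => r; move: leqV; rewrite -/q; move: q #|_| => k n; clear; nia.
Qed.

End Blocks.

(** * Counting vertices *)

Section Count.
Variables (V : finType) (a : rel V) (t : nat).
Hypotheses (t2 : 1 < t) (sa : symmetric a) (ia : irreflexive a).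
Hypothesis adma : forall v, t * t.-1 <= tau a v.
Hypothesis exta : forall b : rel V, symmetric b -> irreflexive b ->
  (forall v, t * t.-1 <= tau b v) -> arcs a <= arcs b.
Hypothesis no_isolated : forall Q : {set V}, #|Q| = t.+1 ->
  {in Q &, forall x y, x != y -> a x y} ->
  exists2 x, x \in Q & exists2 y, y \notin Q & a x y.
Implicit Types (x y z u v w h : V) (Q : {set V}).

Definition low : {set V} := [set v | #|nbr a v| == t].
Definition excess v := #|nbr a v| - t.
Definition total_excess := \sum_v excess v.
Definition ball v := v |: nbr a v.

Lemma in_ball v x : (x \in ball v) = (x == v) || a v x.
Proof. by rewrite in_setU1 in_nbr. Qed.

Lemma deg_ge v : t <= #|nbr a v|.
Proof.
rewrite leqNgt; apply/negP => lt.
have := adma v; rewrite tau_sum => /leq_trans /(_ (sum_nbr_le ia _)).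
by move: lt t2; move: #|_| => d; clear; nia.
Qed.

Lemma deg_excess v : #|nbr a v| = t + excess v.
Proof. by rewrite subnKC // deg_ge. Qed.

Lemma excess_gt0 v : v \notin low -> 0 < excess v.
Proof. by rewrite inE subn_gt0 ltn_neqAle eq_sym deg_ge andbT. Qed.

(** The degree sum is [#|V| * t + total_excess]; compare it with that of the block graph. *)
Lemma total_excess_le : total_excess <= t * t.
Proof.
have [V0|[v _]] := set_0Vmem [set: V].
  by rewrite /total_excess big1 // => v; have := in_set0 v; rewrite -V0 inE.
have ltV : t < #|V|.
  rewrite -cardsT (cardsD1 v) in_setT ltnS; apply: leq_trans (deg_ge v) _.
  apply: subset_leq_card; apply/subsetP => x; rewrite in_nbr in_setD1 in_setT.
  by rewrite andbT; apply: contraTneq => ->; rewrite ia.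
have := exta (add_sym _ (block_sym _)) (block_graph_irrefl ltV)
  (block_graph_tau ltV).
move/leq_trans/(_ (block_graph_arcs ltV)); rewrite arcs_deg.
under eq_bigr => x _ do rewrite deg_excess.
by rewrite big_split /= sum_nat_const leq_add2l.
Qed.

(** Among [t] neighbours there are only [t * t.-1] ordered pairs, and admissibility requires all of
    them to be adjacent. *)
Lemma low_clique v : v \in low -> {in nbr a v &, forall x y, x != y -> a x y}.
Proof.
rewrite inE => /eqP dv x y xv yv xy; apply: contraT => naxy.
have := adma v; rewrite tau_sum (bigD1 x) //=.
have le z : z \in nbr a v -> #|nbr a v :&: nbr a z| <= t.-1.
  move=> zv; rewrite -dv (cardsD1 z (nbr a v)) zv /=; apply: subset_leq_card.
  apply/subsetP => w /setIP [wv]; rewrite in_nbr => azw; rewrite in_setD1 wv.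
  by rewrite andbT; apply: contraTneq azw => ->; rewrite ia.
have lex : #|nbr a v :&: nbr a x| <= t.-2.
  have := cardsD1 x (nbr a v); have := cardsD1 y (nbr a v :\ x).
  rewrite in_setD1 [y == x]eq_sym xy xv yv dv /= => e1 e2.
  apply: (@leq_trans #|nbr a v :\ x :\ y|); last by move: e1 e2; clear; lia.
  apply: subset_leq_card; apply/subsetP => w /setIP [wv]; rewrite in_nbr => axw.
  rewrite !in_setD1 wv andbT; apply/andP; split.
    by apply: contraTneq axw => ->.
  by apply: contraTneq axw => ->; rewrite ia.
have ler : \sum_(i in nbr a v | i != x) #|nbr a v :&: nbr a i| <= t.-1 * t.-1.
  rewrite -{1}dv (cardsD1 x (nbr a v)) xv /= -sum_nat_const.
  apply: (@leq_trans (\sum_(i in nbr a v | i != x) t.-1)).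
    by apply: leq_sum => z /andP [zv _]; apply: le.
  by apply: eq_leq; apply: eq_bigl => z; rewrite in_setD1 andbC.
move: lex ler t2; move: #|_| (\sum_(_ in _ | _) _) => k s; clear; nia.
Qed.

Lemma ball_card v : v \in low -> #|ball v| = t.+1.
Proof. by rewrite inE cardsU1 in_nbr ia => /eqP ->. Qed.

Lemma ball_clique v : v \in low -> {in ball v &, forall x y, x != y -> a x y}.
Proof.
move=> vl x y; rewrite !in_ball => /orP [/eqP ->|vx] /orP [/eqP ->|vy] //.
- by rewrite eqxx.
- by rewrite sa.
by apply: (low_clique vl); rewrite in_nbr.
Qed.

Lemma ball_eq u v : u \in low -> v \in low -> v \in ball u -> ball u = ball v.
Proof.
move=> ul vl vu; apply/eqP; rewrite eqEcard !ball_card // leqnn andbT.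
apply/subsetP => x xu; rewrite in_ball; case: eqVneq => //= xv.
by apply: (ball_clique ul) => //; rewrite eq_sym.
Qed.

Lemma ball_self v : v \in ball v. Proof. by rewrite in_ball eqxx. Qed.

(** Once these vertices are set aside, the balls of the remaining low vertices are pairwise equal or
    disjoint. *)
Definition shared : {set V} :=
  [set u in low | [exists h, exists u',
     [&& a u h, u' \in low, a h u', u' != u & ~~ a u u']]].

(* Low neighbours of h in different lights are non-adjacent, and h has exactly
excess h neighbours outside each of these lights. *)
Lemma card_low_nbr h u u' : u \in low -> u' \in low -> a u h -> a h u' ->
  u' != u -> ~~ a u u' -> #|low :&: nbr a h| <= 2 * excess h.
Proof.
move=> ul u'l auh ahu' u'u nauu'.
have out v : v \in low -> a v h -> #|nbr a h :\: ball v| <= excess h.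
  move=> vl avh; have hv : h \in ball v by rewrite in_ball avh orbT.
  rewrite cardsD /excess leq_sub2l //.
  have := cardsD1 h (ball v); rewrite hv ball_card // => -[{1}->].
  apply: subset_leq_card; apply/subsetP => x /setD1P [xh xv].
  by rewrite in_setI xv in_nbr (ball_clique vl) // eq_sym.
rewrite mul2n -addnn.
have au'h : a u' h by rewrite sa.
apply: leq_trans (leq_add (out _ ul auh) (out _ u'l au'h)).
apply: leq_trans (leq_card_setU _ _); apply: subset_leq_card.
apply/subsetP => w /setIP [wl wh]; rewrite in_setU !in_setD wh !andbT -negb_and.
apply/negP => /andP [wu wu'].
have := ball_self u'; rewrite (ball_eq u'l wl wu') -(ball_eq ul wl wu).
by rewrite in_ball (negbTE u'u) (negbTE nauu').
Qed.

(** Charge each shared vertex to a common neighbour [h] that witnesses it, and apply [card_low_nbr]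
    to [h]. *)
Lemma card_shared : #|shared| <= 2 * total_excess.
Proof.
pose S := [set h | #|low :&: nbr a h| <= 2 * excess h].
apply: (@leq_trans #|\bigcup_(h in S) (low :&: nbr a h)|).
  apply: subset_leq_card; apply/subsetP => u; rewrite inE => /andP [ul].
  case/existsP => h /existsP [u' /and5P [auh u'l ahu' u'u nauu']].
  apply/bigcupP; exists h; last by rewrite in_setI ul in_nbr sa.
  by rewrite inE; apply: card_low_nbr auh ahu' u'u nauu'.
apply: (@leq_trans (\sum_(h in S) #|low :&: nbr a h|)).
  elim/big_rec2: _ => [|h B n _ le]; first by rewrite cards0.
  by apply: leq_trans (leq_card_setU _ _) _; rewrite leq_add2l.
rewrite /total_excess big_distrr /= big_mkcond; apply: leq_sum => h _.
by rewrite inE; case: ifP.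
Qed.

Definition lights : {set {set V}} := ball @: (low :\: shared).

Lemma unshared_nbr u h u' : u \in low :\: shared -> a u h -> u' \in low ->
  a h u' -> u' \in ball u.
Proof.
rewrite in_setD => /andP [nsh ul] auh u'l ahu'; rewrite in_ball.
apply: contraR nsh; rewrite negb_or => /andP [u'u nauu'].
rewrite inE ul; apply/existsP; exists h; apply/existsP; exists u'.
by rewrite auh u'l ahu' u'u.
Qed.

Lemma lights_eq u u' w : u \in low :\: shared -> u' \in low :\: shared ->
  w \in ball u -> w \in ball u' -> ball u = ball u'.
Proof.
move=> uL u'L; have [ul _] := setDP uL; have [u'l _] := setDP u'L.
rewrite in_ball => /orP [/eqP -> wu'|auw].
  exact: (esym (ball_eq u'l ul wu')).
rewrite in_ball => /orP [/eqP wu'|au'w].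
  by apply: ball_eq; rewrite // -wu' in_ball auw orbT.
by apply: ball_eq => //; apply: (unshared_nbr uL auw); rewrite // sa.
Qed.

Lemma lights_disjoint : {in lights &, forall Q Q', Q != Q' -> [disjoint Q & Q']}.
Proof.
move=> _ _ /imsetP [u uL ->] /imsetP [u' u'L ->]; apply: contraR.
rewrite -setI_eq0 => /set0Pn [w /setIP [wu wu']].
by apply/eqP; apply: lights_eq wu wu'.
Qed.

Definition level Q := \max_(y in ~: Q) #|nbr a y :&: Q|.
Definition outflow Q := \sum_(y in ~: Q) #|nbr a y :&: Q|.

Lemma level_attained Q : Q \in lights ->
  0 < level Q /\ exists2 y, y \notin Q & #|nbr a y :&: Q| = level Q.
Proof.
case/imsetP => u /setDP [ul _] ->.
have [x xQ [y yQ axy]] := no_isolated (ball_card ul) (ball_clique ul).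
have yC : y \in ~: ball u by rewrite in_setC.
split.
  apply: leq_trans (leq_bigmax_cond (F := fun y => #|nbr a y :&: ball u|) y yC).
  by rewrite card_gt0; apply/set0Pn; exists x; rewrite in_setI xQ in_nbr sa axy.
have := @eq_bigmax_cond _ (mem (~: ball u)) (fun y => #|nbr a y :&: ball u|).
rewrite card_gt0 => -[|z]; first by apply/set0Pn; exists y.
by rewrite inE => zQ e; exists z; rewrite // -e.
Qed.

(** An outside neighbour of degree [t] would be low, hence in the ball, because the centre of the
    ball is not shared. *)
Lemma light_of Q : Q \in lights -> 2 * outflow Q <= t -> light a t (level Q) Q.
Proof.
case/imsetP => u uL -> ofl; have [ul _] := setDP uL.
split=> //; first exact: ball_card; first exact: ball_clique.
- move=> x y xQ yQ axy; rewrite ltn_neqAle deg_ge andbT eq_sym.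
  apply: contraNN yQ => dy; have yl : y \in low by rewrite inE.
  move: xQ; rewrite in_ball => /orP [/eqP <-|aux]; first by rewrite in_ball axy orbT.
  by apply: unshared_nbr uL aux yl axy.
move=> y yQ; have yC : y \in ~: ball u by rewrite in_setC.
exact: (leq_bigmax_cond (F := fun y => #|nbr a y :&: ball u|) y yC).
Qed.

(** Each vertex of [Q] has exactly [t] neighbours inside [Q], so its excess counts its edges leaving
    [Q]. *)
Lemma outflow_excess Q : Q \in lights -> outflow Q = \sum_(z in Q) excess z.
Proof.
case/imsetP => u /setDP [ul _] ->.
rewrite /outflow; under eq_bigr => y _ do rewrite setIC.
rewrite sum_nbr_exchange //; apply: eq_bigr => z zQ.
have := cardsID (ball u) (nbr a z); rewrite deg_excess.
have -> : #|nbr a z :&: ball u| = t.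
  have := cardsD1 z (ball u); rewrite zQ ball_card // => -[->].
  apply: eq_card => x; rewrite in_setI in_setD1 in_nbr.
  case xQ: (x \in ball u); rewrite ?andbF // !andbT.
  case: eqVneq => [->|xz] /=; first by rewrite ia.
  by rewrite (ball_clique ul) // eq_sym.
by move/eqP; rewrite eqn_add2l => /eqP <-; rewrite setDE setIC.
Qed.

(** Lights are disjoint, so their outflows sum to at most the total excess, and twice the outflow of
    a heavy light is at least [t.+1]. *)
Lemma card_heavy :
  #|[set Q in lights | t < 2 * outflow Q]| * t.+1 <= 2 * total_excess.
Proof.
set P := [set Q in _ | _].
have trivP : trivIset P.
  apply/trivIsetP => Q Q'; rewrite !inE => /andP [QL _] /andP [Q'L _].
  exact: lights_disjoint.
rewrite -sum_nat_const.
apply: (@leq_trans (\sum_(Q in P) 2 * \sum_(z in Q) excess z)).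
  by apply: leq_sum => Q; rewrite inE => /andP [QL]; rewrite outflow_excess.
rewrite -big_distrr /= -(big_trivIset _ trivP) /= leq_mul2l /=.
by rewrite /total_excess [leqRHS](bigID [in cover P]) /= leq_addr.
Qed.

Lemma card_nonheavy : #|[set Q in lights | 2 * outflow Q <= t]| <= t./2.
Proof.
set P := [set Q in _ | _].
have PP Q : Q \in P -> Q \in lights /\ light a t (level Q) Q.
  by rewrite inE => /andP [QL ofl]; split=> //; apply: light_of.
have lev Q : Q \in P -> (level Q).-1 < t./2.-1.+1.
  move=> /PP [QL L]; have [l0 [y yQ e]] := level_attained QL.
  have := light_nbr L yQ; rewrite e; move: l0 t2; clear; lia.
(* Levels lie between 1 and [t./2], so they are shifted to start at 0. The bound is written as a
   successor for [inord]. *)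
have inj : {in P &, injective (fun Q => inord (level Q).-1 : 'I_(t./2.-1.+1))}.
  move=> Q Q' QP Q'P /(congr1 val) /=; rewrite !inordK ?lev // => e.
  have [QL L] := PP _ QP; have [Q'L L'] := PP _ Q'P.
  have [l0 at1] := level_attained QL; have [l0' at2] := level_attained Q'L.
  have {}e : level Q' = level Q by move: e l0 l0'; clear; lia.
  apply/eqP; apply: contraT => /(lights_disjoint QL Q'L) dQ.
  rewrite e in L' at2.
  by case: (two_lights sa ia adma exta l0 L L' dQ at1 at2).
rewrite -(card_in_imset inj); apply: leq_trans (max_card _) _.
rewrite card_ord; move: t2; clear; lia.
Qed.

(** With X the total excess, there are at most X high, 2X shared and 2X + t(t+1)/2 unshared low
    vertices. Since X <= t^2 and t > 1, the sum 5X + t(t+1)/2 is below 6t^2. *)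
Lemma few_vertices : #|V| < 6 * t ^ 2.
Proof.
have cover_unshared : #|low :\: shared| <= #|lights| * t.+1.
  apply: (@leq_trans #|cover lights|).
    apply: subset_leq_card; apply/subsetP => u uL; apply/bigcupP.
    by exists (ball u); [apply: imset_f|apply: ball_self].
  apply: leq_trans (leq_card_cover _) _; rewrite -sum_nat_const.
  by apply: leq_sum => _ /imsetP [u /setDP [ul _] ->]; rewrite ball_card.
have card_lights : #|lights| <= #|[set Q in lights | t < 2 * outflow Q]|
    + #|[set Q in lights | 2 * outflow Q <= t]|.
  apply: leq_trans (leq_card_setU _ _); apply: subset_leq_card.
  by apply/subsetP => Q QL; rewrite !inE QL /=; case: ltnP.
have card_high : #|~: low| <= total_excess.
  rewrite /total_excess -sum1_card [leqRHS](bigID [in ~: low]) /=.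
  apply: leq_trans (leq_addr _ _); apply: leq_sum => v.
  by rewrite in_setC => /excess_gt0.
have lights_le : #|lights| * t.+1 <= 2 * total_excess + t./2 * t.+1.
  apply: leq_trans (leq_add card_heavy (leqnn _)); rewrite -mulnDl leq_mul2r /=.
  by apply: leq_trans card_lights _; rewrite leq_add2l card_nonheavy.
have unshared_le := leq_trans cover_unshared lights_le.
have shared_le : #|low :&: shared| <= 2 * total_excess.
  by apply: leq_trans card_shared; rewrite subset_leq_card // subsetIr.
have half : 2 * (t./2 * t.+1) <= t * t.+1.
  by rewrite mulnA leq_mul2r /= mul2n -{2}(odd_double_half t) leq_addl.
have := cardsC low; have := cardsID shared low; have := total_excess_le.
move: card_high shared_le unshared_le half t2; rewrite -mulnn.
move: total_excess (t./2 * t.+1) #|low :&: _| #|low :\: _| #|low| #|~: low|.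
by move=> x h s d k e; move: #|_|; clear; nia.
Qed.

End Count.

(** * From ordered pairs to edges and triangles of a graph *)

Lemma card_imset_double (T T' : finType) (f : T -> T') (S : {set T}) :
  {in S, forall p, #|[set q in S | f q == f p]| = 2} -> #|S| = 2 * #|f @: S|.
Proof.
move=> fib; rewrite -sum1_card (partition_big_imset f) /= mulnC -sum_nat_const.
by apply: eq_bigr => _ /imsetP [p pS ->]; rewrite sum1dep_card fib.
Qed.

Section Bridge.
Variable G : sgraph.
Implicit Types v x y z : G.

Lemma arcs_edges : arcs (@adj G) = 2 * num_edges G.
Proof.
rewrite /num_edges /edge_set /arcs.
apply: card_imset_double => -[x y]; rewrite inE /= => axy.
have xy : x != y by apply: contraTneq axy => ->; rewrite adj_irrefl.
rewrite (_ : [set _ in _ | _] = [set (x, y); (y, x)]).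
  by rewrite cards2 xpair_eqE (negbTE xy).
apply/setP => -[u v]; rewrite !inE !xpair_eqE /=; apply/andP/orP.
  move=> [auv /eqP e]; have uv : u != v.
    by apply: contraTneq auv => ->; rewrite adj_irrefl.
  have := set21 u v; have := set22 u v; rewrite e !inE.
  case/orP => /eqP ev /orP [] /eqP eu; move: uv; rewrite eu ev ?eqxx // => _.
    by right; rewrite ?eqxx.
  by left; rewrite ?eqxx.
case=> /andP [/eqP -> /eqP ->]; first by rewrite axy eqxx.
by rewrite adj_sym axy setUC eqxx.
Qed.

Lemma tau_triangles v : tau (@adj G) v = 2 * #|triangles_at v|.
Proof.
pose f (p : G * G) := v |: [set p.1; p.2].
have linkP p : p \in link (@adj G) v ->
    [/\ v != p.1, v != p.2, p.1 != p.2 & f p \in triangles_at v].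
  case: p => x y; rewrite inE /= => /and3P [avx avy axy].
  have vx : v != x by apply: contraTneq avx => ->; rewrite adj_irrefl.
  have vy : v != y by apply: contraTneq avy => ->; rewrite adj_irrefl.
  have xy : x != y by apply: contraTneq axy => ->; rewrite adj_irrefl.
  split=> //; rewrite inE; apply/and3P; split.
  - by rewrite cardsU1 !inE negb_or vx vy cards2 xy.
  - apply/forall_inP => z1 z1S; apply/forall_inP => z2 z2S; apply/implyP.
    move: z1S z2S; rewrite !inE => /or3P [] /eqP -> /or3P [] /eqP ->;
      by rewrite ?eqxx // adj_sym.
  - by rewrite !inE eqxx.
have -> : triangles_at v = f @: link (@adj G) v.
  apply/setP => S; apply/idP/imsetP => [|[p pl ->]]; last by case: (linkP _ pl).
  rewrite inE => /and3P [S3 clS vS].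
  have : #|S :\ v| == 2 by have := cardsD1 v S; rewrite vS (eqP S3) add1n => -[<-].
  move=> /cards2P [x [y [xy e]]].
  have [xS yS] : x \in S :\ v /\ y \in S :\ v by rewrite e !inE !eqxx orbT.
  have /setD1P [xv xS'] := xS; have /setD1P [yv yS'] := yS.
  have adjS z1 z2 : z1 \in S -> z2 \in S -> z1 != z2 -> adj z1 z2.
    by move=> z1S z2S; move/forall_inP: clS => /(_ _ z1S) /forall_inP /(_ _ z2S) /implyP.
  exists (x, y); last by rewrite /f /= -e setD1K.
  by rewrite inE /= !adjS // eq_sym.
apply: card_imset_double => -[x y] pl; have [vx vy xy _] := linkP _ pl.
rewrite /= in vx vy xy.
rewrite (_ : [set _ in _ | _] = [set (x, y); (y, x)]).
  by rewrite cards2 xpair_eqE (negbTE xy).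
apply/setP => -[u w]; rewrite [LHS]inE [RHS]inE !inE !xpair_eqE /=.
apply/andP/orP => [[ql /eqP e]|].
  have ql' : (u, w) \in link (@adj G) v by rewrite inE.
  have [vu vw uw _] := linkP _ ql'.
  rewrite /= in vu vw uw.
  have : u \in f (x, y) by rewrite -e !inE eqxx orbT.
  have : w \in f (x, y) by rewrite -e !inE eqxx !orbT.
  rewrite !inE /= [w == v]eq_sym [u == v]eq_sym (negbTE vu) (negbTE vw) /=.
  case/orP => /eqP ew /orP [] /eqP eu; move: uw; rewrite eu ew ?eqxx // => _.
    by right; rewrite ?eqxx.
  by left; rewrite ?eqxx.
move: pl; rewrite inE /= => /and3P [avx avy axy].
case=> /andP [/eqP -> /eqP ->]; first by rewrite avx avy axy eqxx.
by rewrite avx avy adj_sym axy /f /= [[set x; y]]setUC eqxx.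
Qed.

End Bridge.

Lemma admissible_tau t (G : sgraph) :
  admissible t G <-> forall v : G, t * t.-1 <= tau (@adj G) v.
Proof.
have e : t * t.-1 = 2 * 'C(t, 2).
  by have := bin_ffact t 2; rewrite ffactnS ffactn1 mulnC.
by split=> adm v; have := adm v; rewrite tau_triangles e leq_mul2l.
Qed.

Lemma extremal_isolated_clique t (G : sgraph) :
  1 < t -> extremal t G -> 6 * t ^ 2 <= #|G| ->
  exists S : {set G}, isolated_clique t.+1 S.
Proof.
move=> t2 [/admissible_tau adm ext] large.
have [/existsP [S /and3P [/eqP cS clS /forall_inP isoS]]|none] :=
  boolP [exists S : {set G}, [&& #|S| == t.+1, clique S &
    [forall x in S, forall y, (y \notin S) ==> ~~ adj x y]]].
  exists S; split=> // x y xS yS.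
  by have /forallP /(_ y) := isoS _ xS; rewrite yS.
move: large; rewrite leqNgt => /negP []; apply: few_vertices t2 _ _ adm _ _.
- exact: adj_sym.
- exact: adj_irrefl.
- move=> b sb ib tb; rewrite arcs_edges.
  have := ext (SGraph sb ib) erefl; rewrite admissible_tau => /(_ tb) le.
  by have := @arcs_edges (SGraph sb ib); rewrite /= => ->; rewrite leq_mul2l.
move=> Q cQ clQ.
suff /exists_inP [x xQ /exists_inP [y yQ axy]] :
    [exists x in Q, exists y in ~: Q, adj x y].
  by exists x => //; exists y; rewrite // in_setC in yQ.
apply: contraR none => /exists_inPn noQ.
have clQ' : clique Q.
  apply/forall_inP => x xQ; apply/forall_inP => y yQ; apply/implyP.
  exact: clQ.
apply/existsP; exists Q; rewrite cQ eqxx clQ' /=.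
apply/forall_inP => x xQ; apply/forallP => y; apply/implyP => yQ.
by apply: contra (noQ _ xQ) => axy; apply/exists_inP; exists y; rewrite ?in_setC.
Qed.

(* The bound with the real constant *)
From mathcomp Require Import all_boot all_order all_algebra.
From mathcomp Require Import all_classical all_reals all_analysis.
From mathcomp Require Import lra.
Import Order.TTheory GRing.Theory Num.Theory.
Import numFieldNormedType.Exports.
Local Open Scope classical_set_scope.
Local Open Scope ring_scope.

Theorem theorem6 (R : realType) :
  let c : R := 1 + Num.sqrt (928%:R / 33%:R) in
  exists (h : nat -> R) (t0 : nat),
    h =o_\oo (fun t : nat => t%:R ^+ 2 : R) /\
    forall t n : nat, (2 <= t)%N -> (t0 <= t)%N ->
      c * t%:R ^+ 2 + h t <= n%:R ->
      forall G : sgraph, #|G| = n -> extremal t G ->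
        exists S : {set G}, isolated_clique t.+1 S.
Proof.
(* The error term can be zero, since [6 * t ^ 2] vertices suffice for every [t] from 2 on and [c] is
   at least 6. *)
move=> c; exists (fun=> 0), 2%N; split.
  by apply/eqoP => e e0; near=> t; rewrite normr0 mulr_ge0 // ltW.
move=> t n t2 _; rewrite addr0 => large G cardG extG.
apply: extremal_isolated_clique extG _ => //; rewrite cardG.
rewrite -(ler_nat R) natrM natrX; apply: le_trans large.
rewrite ler_wpM2r ?exprn_ge0 //.
(* This holds because 928/33 exceeds 25. *)
have : (5%:R : R) <= Num.sqrt (928%:R / 33%:R).
  rewrite -(ler_sqr _ _) ?nnegrE ?sqrtr_ge0 // sqr_sqrtr; lra.
rewrite /c; lra.
Unshelve. all: by end_near.
Qed.
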